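(* Let $H$ be an infinitely divisible distribution supported on $[0,\infty)$ with Laplace transform $$\int_0^\infty e^{-\lambda y}H(dy)=\exp\Big\{-a\lambda-\int_0^\infty(1-e^{-\lambda y})\upsilon(dy)\Big\},$$ with Lévy spectral distribution $F$ and decomposition $H=H_1*H_2$ (as in the context). For some constant $0<T<\infty$, assume that $H\in\mathcal{TL}_{\Delta_T}(\gamma)\cap\mathcal{OS}_{\Delta_T}$ for some $\gamma>0$ and $H_1(x+\Delta_T)=o\big(H_2(x+\Delta_T)\big)$. In addition, suppose that for all $k\ge1$, $$\liminf_{x\to\infty}\frac{F_\gamma^{*k}(x-t+\Delta_T)}{F_\gamma^{*k}(x+\Delta_T)}\ge1\quad\text{for all } t>0 .$$ Then $$H_2=F^{*\tau}\in\mathcal{TL}_{\Delta_T}(\gamma)\cap\mathcal{OS}_{\Delta_T}\quad\text{and}\quad H_2(x+\Delta_T)\approx H(x+\Delta_T).$$ And there exists an integer $n_0\ge1$ such that $F^{*n}\in\mathcal{TL}_{\Delta_T}(\gamma)\cap\mathcal{OS}_{\Delta_T}$ for all $n\ge n_0$. Further, if $n_0\ge2$ and if there exists an integer $1\le l_0\le n_0-1$ such that $F^{*l_0}\in\mathcal{OS}_{\Delta_T}$, then $F^{*n}\in\mathcal{TL}_{\Delta_T}(\gamma)\cap\mathcal{OS}_{\Delta_T}$ for all $n\ge l_0$. In particular, if $l_0=1$, that is, $F\in\mathcal{OS}_{\Delta_T}$, then $F\in\mathcal{TL}_{\Delta_T}(\gamma)\,(\cap\,\mathcal{OS}_{\D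elta_T})$.
   Context: All limits are as $x\to\infty$. $\overline V=1-V$; $V^{*k}$ is the $k$-fold convolution of $V$ with itself, $V^{*0}$ being degenerate at $0$. $f\approx g$ means $f=O(g)$ and $g=O(f)$; $f\sim g$ means $f/g\to1$. Lévy data: $a\ge0$ is a constant; $\upsilon$ is a Borel measure on $(0,\infty)$ with $\mu:=\upsilon((1,\infty))\in(0,\infty)$ and $\int_0^1y\,\upsilon(dy)<\infty$. The Lévy spectral distribution is $F(x)=\frac{\upsilon((1,x])}{\mu}\mathbf 1(x>1)$. In the decomposition $H=H_1*H_2$, $H_2(x)=e^{-\mu}\sum_{k=0}^\infty F^{*k}(x)\mu^k/k!$ (so $H_2=F^{*\tau}$ with $\tau$ Poisson with mean $\mu$) and $H_1$ is the infinitely divisible distribution with drift $a$ and Lévy measure $\upsilon$ restricted to $(0,1]$; it satisfies $\overline{H_1}(x)=O(e^{-\beta x})$ for some constant $\beta>0$. Local notation: for $0<T<\infty$, $V(x+\Delta_T)=V((x,x+T])$; $V(x-t+\Delta_T)$ is the same with $x$ replaced by $x-t$. Esscher transform: for $V$ supported on $[0,\infty)$ and $\gamma\ne0$ with $M(V,\gamma)=\int_{[0,\infty)}e^{\gamma y}V(dy)<\infty$, $V_\gamma(x)=\mathbf 1(x\ge0)\int_{[0,x]}e^{\gamma y}V(dy)/M(V,\gamma)$. $F_\gamma^{*k}=(F_\gamma)^{*k}=(F^{*k})_\gamma$. Classes (for fixed $0<T<\infty$): $V\in\mathcal L_{\Delta_T}$ if $V(x+\Delta_T)>0$ for all $x>0$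 and $V(x-t+\Delta_T)\sim V(x+\Delta_T)$ for all $t>0$. $V\in\mathcal{OS}_{\Delta_T}$ if $\limsup V^{*2}(x+\Delta_T)/V(x+\Delta_T)<\infty$. $\mathcal{TL}_{\Delta_T}(\gamma)=\{V: M(V,\gamma)<\infty\text{ and }V_\gamma\in\mathcal L_{\Delta_T}\}$.
   Formalization: In the class L_{Δ_T} (hence TL_{Δ_T}(γ)) positivity of V(x+Δ_T) is required only for all large x, not for all x>0, since F^{*n} does not charge (0,n]; OS_{Δ_T} likewise includes positivity for large x. *)

(* Defs.v *)
From HB Require Import structures.
From mathcomp Require Import all_boot all_order all_algebra.
From mathcomp Require Import all_classical all_reals all_analysis.
From mathcomp Require Import measurable_realfun.
Set Implicit Arguments.
Unset Strict Implicit.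
Unset Printing Implicit Defensive.
Import Order.TTheory GRing.Theory Num.Theory.
Import numFieldNormedType.Exports.
Local Open Scope classical_set_scope.
Local Open Scope ring_scope.

(* A distribution V is represented by its Borel probability measure, so that
   V(x) is [V `]-oo, x]]. *)
Notation distr R := (probability (measurableTypeR R) R).

Section convolution.
Context {R : realType}.
Implicit Types (V W : distr R) (k : nat).

Definition sum_pair (p : measurableTypeR R * measurableTypeR R)
  : measurableTypeR R := (p.1 : R) + (p.2 : R).

Lemma measurable_sum_pair : measurable_fun [set: _] sum_pair.
Proof.
apply: (@measurable_funD _ _ _ _ (fst : _ -> R) (snd : _ -> R)).
  exact: measurable_fst.
exact: measurable_snd.
Qed.

HB.instance Definition _ :=
  isMeasurableFun.Build _ _ _ _ sum_pair measurable_sum_pair.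

Definition convol V W : distr R := distribution (V \x W)%E sum_pair.

Definition dirac0 : distr R := @dirac _ (measurableTypeR R) (0 : R) R.

Fixpoint convol_pow V k : distr R :=
  if k is k'.+1 then convol V (convol_pow V k') else dirac0.

End convolution.

Section compound_poisson.
Context {R : realType}.
Variables (m : {nonneg R}) (V : distr R).

Lemma poisson_weight_ge0 k : 0 <= expR (- m%:num) * (m%:num ^+ k / k`!%:R) :> R.
Proof. by rewrite mulr_ge0 ?expR_ge0 ?divr_ge0 ?exprn_ge0. Qed.

Definition poisson_weight k : {nonneg R} := NngNum (poisson_weight_ge0 k).

(* The law V^{*tau} with tau Poisson of mean m. *)
Definition compound_poisson : set (measurableTypeR R) -> \bar R :=
  mseries (fun k => mscale (poisson_weight k) (convol_pow V k)) 0.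

HB.instance Definition _ := Measure.on compound_poisson.

Let compound_poisson_setT : compound_poisson [set: _] = 1%E.
Proof.
rewrite /compound_poisson /mseries.
transitivity (\sum_(0 <= k <oo)
    (expR (- m%:num))%:E * (m%:num ^+ k / k`!%:R)%:E)%E.
  apply: eq_eseriesr => k _.
  transitivity ((poisson_weight k)%:num%:E * convol_pow V k [set: _])%E => //.
  by rewrite probability_setT mule1 EFinM.
rewrite nneseriesZl/=; last by move=> n _; rewrite lee_fin divr_ge0 ?exprn_ge0.
rewrite [RHS](_ : _ = ((expR (- m%:num))%:E * (expR m%:num)%:E)%E); last first.
  by rewrite -EFinM expRN mulVf ?gt_eqF ?expR_gt0.
congr *%E; rewrite expRE -EFin_lim; last first.
  rewrite /pseries/=; under eq_fun do rewrite mulrC.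
  exact: is_cvg_series_exp_coeff.
apply/congr_lim/funext => n/=; rewrite /pseries/= /series/= -sumEFin//.
by under eq_bigr do rewrite mulrC.
Qed.

HB.instance Definition _ :=
  Measure_isProbability.Build _ _ _ compound_poisson compound_poisson_setT.

End compound_poisson.

Section esscher.
Context {R : realType}.
Implicit Types (V : distr R) (g : R).

Definition moment V g : \bar R := \int[V]_(y in `[0, +oo[) (expR (g * y))%:E.

Definition tilt V g (A : set (measurableTypeR R)) : \bar R :=
  \int[V]_(y in A `&` `[0, +oo[) (expR (g * y))%:E.

Section tilt_measure.
Variables (V : distr R) (g : R).
Local Open Scope ereal_scope.

Let measurable_expg (D : set (measurableTypeR R)) :
  measurable_fun D (fun y : measurableTypeR R => (expR (g * y))%:E).
Proof.
apply/measurable_EFinP; apply: (@measurable_funTS _ _ R R).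
by apply: measurableT_comp => //; exact: mulrl_measurable.
Qed.

Let tilt0 : tilt V g set0 = 0.
Proof. by rewrite /tilt set0I integral_set0. Qed.

Let tilt_ge0 A : 0 <= tilt V g A.
Proof. by apply: integral_ge0 => y _; rewrite lee_fin expR_ge0. Qed.

Let tilt_sigma_additive : semi_sigma_additive (tilt V g).
Proof.
move=> F mF tF mUF; rewrite /tilt setI_bigcupl ge0_integral_bigcup//=.
- apply: is_cvg_nneseries => n _ _.
  by apply: integral_ge0 => y _; rewrite lee_fin expR_ge0.
- by move=> n; apply: measurableI => //; exact: measurable_itv.
- exact: trivIset_setIr.
Qed.

HB.instance Definition _ :=
  isMeasure.Build _ _ _ (tilt V g) tilt0 tilt_ge0 tilt_sigma_additive.

End tilt_measure.

(* When [moment V g] is infinite (or V does not charge [0, +oo[) the transform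
   is undefined and [mnormalize] returns V itself; the total mass of [tilt V g]
   is [moment V g]. *)
Definition esscher V g : distr R := mnormalize (tilt V g) V.

End esscher.

Section classes.
Context {R : realType}.
Implicit Types (V : distr R) (T x g : R).

(* V(x + Delta_T) = V(]x, x + T]) *)
Definition loc V T x : R := fine (V `]x, x + T]%classic).

(* Positivity is required for all large x, which is where the quotients below
   are taken.  Asking for it at every x > 0 would be unsatisfiable for the
   n-fold convolutions of a law carried by ]1, +oo[ as soon as n > T, since
   these do not charge ]-oo, n]. *)
Definition loc_pos V T : Prop := \forall x \near +oo, 0 < loc V T x.

Definition classL T V : Prop :=
  loc_pos V T /\
  forall t, 0 < t -> loc V T (x - t) / loc V T x @[x --> +oo] --> (1 : R).

Definition classOS T V : Prop :=
  loc_pos V T /\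
  (limf_esup (fun x => (loc (convol V V) T x / loc V T x)%:E) (+oo_R) < +oo)%E.

Definition classTL T g V : Prop :=
  (moment V g < +oo)%E /\ classL T (esscher V g).

Definition at_pinfty : filter_on R := FilterType (+oo_R) _.

Definition negligible_wrt (f h : R -> R^o) : Prop := f =o_at_pinfty h.

Definition weakly_equiv (f h : R -> R^o) : Prop :=
  f =O_at_pinfty h /\ h =O_at_pinfty f.

(* As x / 0 = 0 in R, this forces loc V T x > 0 for all large x, that is, the
   quotient has to make sense. *)
Definition loc_almost_decreasing T V : Prop :=
  forall t, 0 < t ->
    (1 <= limf_einf (fun x => (loc V T (x - t) / loc V T x)%:E) (+oo_R))%E.

End classes.

Section levy.
Context {R : realType}.
Implicit Types (V : distr R) (a : R).

Definition infinitely_divisible V : Prop :=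
  forall n, (0 < n)%N -> exists W : distr R,
    forall A, measurable A -> V A = convol_pow W n A.

(* A Borel measure on ]0, +oo[ is a Borel measure on R null on ]-oo, 0]. *)
Definition levy_data a (nu : {measure set (measurableTypeR R) -> \bar R})
    : Prop :=
  [/\ 0 <= a,
      nu `]-oo, 0]%classic = 0%E,
      (0 < nu `]1%R, +oo[%classic)%E,
      (nu `]1%R, +oo[%classic < +oo)%E &
      (\int[nu]_(y in `]0%R, 1%R]) y%:E < +oo)%E].

(* V is the infinitely divisible law on [0, +oo[ with drift a and Levy
   measure nu. *)
Definition id_law a (nu : {measure set (measurableTypeR R) -> \bar R}) V
    : Prop :=
  [/\ infinitely_divisible V,
      V `]-oo, 0[%classic = 0%E &
      forall l, 0 <= l ->
        \int[V]_(y in `[0, +oo[) expR (- (l * y)) =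
        expR (- (a * l) - \int[nu]_(y in `]0, +oo[) (1 - expR (- (l * y))))].

Variable nu : {measure set (measurableTypeR R) -> \bar R}.

Definition small_jumps : {measure set (measurableTypeR R) -> \bar R} :=
  mrestr nu (measurable_itv `]0, 1]).

Definition big_jumps : {measure set (measurableTypeR R) -> \bar R} :=
  mrestr nu (measurable_itv `]1, +oo[).

Definition levy_mass : {nonneg R} :=
  NngNum (fine_ge0 (measure_ge0 nu `]1, +oo[%classic)).

(* The default value [dirac0] is irrelevant under [levy_data]. *)
Definition spectral_law : distr R := mnormalize big_jumps dirac0.

(* The compound Poisson factor H_2 of H = H_1 * H_2, where H_1 is the law with
   Levy measure [small_jumps]. *)
Definition big_part : distr R := compound_poisson levy_mass spectral_law.

End levy.

(* Main.v *)
Require Import Defs.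
From HB Require Import structures.
From mathcomp Require Import all_boot all_order all_algebra.
From mathcomp Require Import all_classical all_reals all_analysis.
From mathcomp Require Import measurable_realfun ring lra.
Set Implicit Arguments.
Unset Strict Implicit.
Unset Printing Implicit Defensive.
Import Order.TTheory GRing.Theory Num.Theory.
Import numFieldNormedType.Exports.
Local Open Scope classical_set_scope.
Local Open Scope ring_scope.

(** Multiplying by [expR (g * y)] turns the statement at exponent [g] into the
statement at exponent [0].  On laws carried by the half-line with a finite
exponential moment, the Esscher transform commutes with convolution
([esscher_convol]), hence maps compound Poisson laws to compound Poisson laws
([esscher_compound_poisson]); and on a window [`]x, x + T]] it acts as
multiplication by [expR (g * x)], up to bounded factors ([esscher_loc_ge],
[esscher_loc_le]), so that bounds between local probabilities survive it in
both directions.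

It remains to treat [G = G1 * G2], where [G2] is the compound Poisson law
[\sum_k p k * F^{*k}] and [g], [g1], [g2], [f k] are the local probabilities
of [G], [G1], [G2], [F^{*k}].  Three ideas carry this case.

- Up to an error [e * g], the series [g2] is one of its finite partial sums
  ([psum_tail]).  Indeed [G2 * G2 >= p 1 * (F * G2)], and the coefficient of
  [F^{*k}] in [F * G2] is [p k.-1 = k / m * p k]; so the terms of index at
  least [N] contribute at most a multiple of [N^-1] times the local
  probability of [G2 * G2], itself [O(g)] because [G * G] is.  Only finitely
  many of the laws [F^{*k}], each almost decreasing by hypothesis, therefore
  matter at a time.

- The condition [g1 = o(g2)] gives [g x <= 2 * G2 `]x - B, x + T]] for some
  constant [B] ([dominated_psum]).  With the previous point, [g] is bounded by
  a partial sum, hence by [f n] for all large [n], because convolving with a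
  nonnegative law can only increase an almost decreasing local probability
  ([convol_almost_ge]).  So [g], [g2] and [f n] are all comparable.

- Long-tailedness passes from [G] to [G2] and from [G2] to [F^{*k}] by a
  compensation argument: in a sum, or a mixture, of almost decreasing terms,
  one term that drops by a fixed proportion makes the total drop.  For [G2]
  this is [deconvol_almost_increasing], for [F^{*k}] it is
  [convol_pow_almost_increasing]; the latter only asks that [g2 = O(f k)].

Finally, if [F^{*l}] is O-subexponential, then [f l (x - t)] is
[O(f (2 l) x) = O(f l x)] for each [t], and iterating the convolution bound
[convol_le] gives [f (j l) = O(f l)] for all [j].  Hence [g2 = O(f n)] for all
[n >= l], and the third idea applies. *)

(** * Convolutions of laws *)

Section convolution_calculus.
Context {R : realType}.
Implicit Types (U V W : distr R) (S : set (measurableTypeR R)).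

Lemma measurable_addl (x : R) :
  measurable_fun setT (fun y : measurableTypeR R => (x + y : measurableTypeR R)).
Proof. by apply: measurable_funD => //; exact: measurable_cst. Qed.

Lemma integral_convol V W (f : measurableTypeR R -> \bar R) :
  measurable_fun setT f -> (forall x, (0 <= f x)%E) ->
  (\int[convol V W]_z f z = \int[V]_x \int[W]_y f ((x : R) + (y : R))%R)%E.
Proof.
move=> mf f0; rewrite /convol ge0_integral_distribution//.
rewrite fubini_tonelli1//; last by move=> x; exact: f0.
by apply: measurableT_comp => //; exact: measurable_sum_pair.
Qed.

Lemma measurable_indic_sum S : measurable S ->
  measurable_fun setT (fun z : measurableTypeR R * measurableTypeR R =>
    (\1_S (z.1 + z.2)%R)%:E : \bar R).
Proof.
move=> mS; apply/measurable_EFinP.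
apply: (measurableT_comp (f := \1_S : measurableTypeR R -> R)) => //.
exact: measurable_sum_pair.
Qed.

(** The measurability of [x |-> V (S - x)]. *)
Lemma measurable_integral_indic_sum V S : measurable S ->
  measurable_fun setT
    (fun x : measurableTypeR R => \int[V]_y (\1_S ((x : R) + (y : R))%R)%:E)%E.
Proof.
move=> mS.
apply: (measurable_fun_fubini_tonelli_F _ (measurable_indic_sum mS)) => z.
by rewrite lee_fin.
Qed.

Lemma convolE V W S : measurable S ->
  (convol V W S = \int[V]_x \int[W]_y (\1_S ((x : R) + (y : R))%R)%:E)%E.
Proof.
move=> mS; rewrite -(@integral_convol V W (fun z => (\1_S z)%:E)).
- by rewrite integral_indic// setIT.
- exact/measurable_EFinP.
- by move=> x; rewrite lee_fin.
Qed.

Lemma convolC V W S : measurable S -> convol V W S = convol W V S.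
Proof.
move=> mS; rewrite !convolE//.
have f0 (z : measurableTypeR R * measurableTypeR R) :
  (0 <= (\1_S (z.1 + z.2)%R)%:E :> \bar R)%E by rewrite lee_fin.
rewrite (fubini_tonelli _ (measurable_indic_sum mS) f0).
by apply: eq_integral => x _; apply: eq_integral => y _; rewrite addrC.
Qed.

Lemma convolA U V W S : measurable S ->
  convol (convol U V) W S = convol U (convol V W) S.
Proof.
move=> mS; rewrite convolE// integral_convol; last 2 first.
- exact: measurable_integral_indic_sum.
- by move=> x; apply: integral_ge0 => y _; rewrite lee_fin.
rewrite convolE//; apply: eq_integral => x _.
rewrite (@integral_convol V W (fun z : measurableTypeR R => (\1_S (x + z)%R)%:E)).
- by apply: eq_integral => y _; apply: eq_integral => z _; rewrite addrA.
- apply/measurable_EFinP; apply: measurableT_comp => //; exact: measurable_addl.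
- by move=> y; rewrite lee_fin.
Qed.

(** Two measures with the same values on measurable sets may differ as functions
of sets, so the identities between convolutions are stated on measurable
sets only. *)
Definition same_law V W := forall S, measurable S -> V S = W S.

Lemma eq_convol V V' W W' : same_law V V' -> same_law W W' ->
  same_law (convol V W) (convol V' W').
Proof.
move=> VV' WW' S mS; rewrite !convolE//.
rewrite (eq_measure_integral V'); last by move=> *; exact: VV'.
by apply: eq_integral => x _; apply: eq_measure_integral => *; exact: WW'.
Qed.

Lemma convol_dirac0 V : same_law (convol Defs.dirac0 V) V.
Proof.
move=> S mS; rewrite convolE// /Defs.dirac0 integral_dirac//.
  rewrite diracT mul1e; under eq_integral do rewrite add0r.
  by rewrite integral_indic// setIT.
exact: measurable_integral_indic_sum.
Qed.

Lemma convol_powD V m n :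
  same_law (convol_pow V (m + n)) (convol (convol_pow V m) (convol_pow V n)).
Proof.
elim: m => [|m IH] S mS.
  by rewrite add0n convol_dirac0.
rewrite addSn.
transitivity (convol V (convol (convol_pow V m) (convol_pow V n)) S).
  exact: (eq_convol (fun _ _ => erefl) IH).
by rewrite -(convolA V (convol_pow V m) (convol_pow V n)).
Qed.

End convolution_calculus.

(** * Probabilities of windows of fixed length *)

Section local_probabilities.
Context {R : realType}.
Implicit Types (V W : distr R) (S : set (measurableTypeR R)) (x y T : R).

Lemma EFin_prob V S : measurable S -> (fine (V S))%:E = V S.
Proof. by move=> mS; rewrite fineK// fin_num_measure. Qed.

Lemma loc_ge0 V T x : 0 <= loc V T x.
Proof. by rewrite /loc fine_ge0. Qed.
#[local] Hint Resolve loc_ge0 : core.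

Lemma EFin_loc V T x : (loc V T x)%:E = V `]x, x + T]%classic.
Proof. by rewrite EFin_prob//; exact: measurable_itv. Qed.

Lemma loc_le1 V T x : loc V T x <= 1.
Proof. by rewrite -lee_fin EFin_loc probability_le1//; exact: measurable_itv. Qed.

Lemma eq_loc V W T x : same_law V W -> loc V T x = loc W T x.
Proof. by move=> VW; rewrite /loc VW//; exact: measurable_itv. Qed.

Lemma integral_indic_loc V T x y :
  (\int[V]_z (\1_(`]x, (x + T)%R]) ((y : R) + (z : R))%R)%:E)%E =
  (loc V T (x - y))%:E.
Proof.
transitivity (\int[V]_z (\1_(`]x - y, (x - y + T)%R]) z)%:E)%E; last first.
  by rewrite integral_indic ?setIT ?EFin_loc//; exact: measurable_itv.
apply: eq_integral => z _; congr (_%:E).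
rewrite !indicE; congr (_%:R); congr (nat_of_bool _).
by apply/idP/idP; rewrite !inE/= !in_itv/= => ?; lra.
Qed.

Lemma measurable_loc V T x :
  measurable_fun setT (fun y : measurableTypeR R => (loc V T (x - (y : R)))%:E).
Proof.
under eq_fun do rewrite -integral_indic_loc.
by apply: measurable_integral_indic_sum; exact: measurable_itv.
Qed.

Lemma loc_convol V W T x :
  (loc (convol W V) T x)%:E = (\int[W]_y (loc V T (x - (y : R)))%:E)%E.
Proof.
rewrite EFin_loc convolE; last exact: measurable_itv.
by apply: eq_integral => y _; rewrite integral_indic_loc.
Qed.

(** The workhorse for local bounds on convolutions: since [loc (convol W V) T x]
is the [W]-average of [loc V T (x - y)], a pointwise inequality between
windows integrates.  The indicator terms absorb the [y] for which no useful
comparison of windows is available. *)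
Lemma loc_convol_compare V V' W T1 T2 x1 x2 a b c d S1 S2 :
  0 <= a -> 0 <= b -> 0 <= c -> 0 <= d -> measurable S1 -> measurable S2 ->
  (forall y : R, a * loc V T1 (x1 - y) + b * \1_S1 y <=
                 c * loc V' T2 (x2 - y) + d * \1_S2 y) ->
  a * loc (convol W V) T1 x1 + b * fine (W S1) <=
  c * loc (convol W V') T2 x2 + d * fine (W S2).
Proof.
move=> a0 b0 c0 d0 mS1 mS2 h.
have E (k l x T : R) U S : 0 <= k -> 0 <= l -> measurable S ->
    (k * loc (convol W U) T x + l * fine (W S))%:E =
    (\int[W]_y (k * loc U T (x - (y : R)) + l * \1_S y)%:E)%E.
  move=> k0 l0 mS; rewrite EFinD 2!EFinM loc_convol (EFin_prob _ mS).
  under [RHS]eq_integral do rewrite EFinD 2!EFinM.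
  rewrite ge0_integralD//=.
  - rewrite !ge0_integralZl//=.
    + by rewrite integral_indic// setIT.
    + exact/measurable_EFinP.
    + exact: measurable_loc.
    + by move=> y _; rewrite lee_fin.
  - by move=> y _; rewrite lee_fin mulr_ge0.
  - by apply: emeasurable_funM => //; exact: measurable_loc.
  - by move=> y _; rewrite lee_fin mulr_ge0.
  - by apply: emeasurable_funM => //; exact/measurable_EFinP.
have M (k l x T : R) U S : measurable S ->
    measurable_fun setT (fun y : measurableTypeR R =>
      (k * loc U T (x - (y : R)) + l * \1_S y)%:E).
  move=> mS; under eq_fun do rewrite EFinD 2!EFinM.
  apply: emeasurable_funD; apply: emeasurable_funM => //.
    exact: measurable_loc.
  exact/measurable_EFinP.
rewrite -lee_fin !E//; apply: ge0_le_integral => //; try exact: M.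
  by move=> y _; rewrite lee_fin addr_ge0 ?mulr_ge0.
by move=> y _; rewrite lee_fin; exact: h.
Qed.

End local_probabilities.

#[local] Hint Resolve loc_ge0 : core.

(** * Bounds that hold near infinity *)

Section eventual_bounds.
Context {R : realType}.
Implicit Types (f h v : R -> R) (c t e x : R).

Lemma near_pinfty_shift (P : R -> Prop) t :
  (\forall x \near +oo, P x) -> \forall x \near +oo, P (x + t).
Proof.
move=> [M [Mr MP]]; exists (M - t); split; first exact: num_real.
by move=> x Mx; apply: MP; lra.
Qed.

Lemma near_pinfty_gt t : \forall x \near +oo, t < x.
Proof. by apply: nbhs_pinfty_gt; exact: num_real. Qed.

(** For nonnegative functions, the relation [f = O(h)]. *)
Definition dominated f h : Prop :=
  exists2 C, 0 < C & \forall x \near +oo, f x <= C * h x.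

Lemma dominated_refl f : dominated f f.
Proof. by exists 1 => //; apply: nearW => x; rewrite mul1r. Qed.

Lemma dominated_le f h : (\forall x \near +oo, f x <= h x) -> dominated f h.
Proof. by move=> fh; exists 1 => //; apply: filterS fh => x; rewrite mul1r. Qed.

Lemma dominated_trans h f v : dominated f h -> dominated h v -> dominated f v.
Proof.
move=> [C C0 fh] [D D0 hv]; exists (C * D); first exact: mulr_gt0.
apply: filterS2 fh hv => x fx hx; rewrite -mulrA.
by rewrite (le_trans fx)// ler_pM2l.
Qed.

Lemma dominated_shift t f h : dominated f h ->
  dominated (fun x => f (x + t)) (fun x => h (x + t)).
Proof.
by move=> [C C0 fh]; exists C => //; exact: (near_pinfty_shift t fh).
Qed.

Lemma dominatedD f f' h : dominated f h -> dominated f' h ->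
  dominated (fun x => f x + f' x) h.
Proof.
move=> [C C0 fh] [D D0 hv]; exists (C + D); first exact: addr_gt0.
by apply: filterS2 fh hv => x fx hx; rewrite mulrDl lerD.
Qed.

Lemma dominatedZ c f h : (forall x, 0 <= h x) -> 0 <= c -> dominated f h ->
  dominated (fun x => c * f x) h.
Proof.
move=> h0 c0 [C C0 fh]; exists (c * C + 1).
  by rewrite ltr_wpDl// mulr_ge0// ltW.
apply: filterS fh => x fx; rewrite mulrDl -mulrA mul1r.
by rewrite ler_wpDr// ler_wpM2l.
Qed.

Lemma dominated0 h : (forall x, 0 <= h x) -> dominated (fun=> 0) h.
Proof. by move=> h0; apply: dominated_le; exact: nearW. Qed.

Lemma dominated_sum n (f : nat -> R -> R) h : (forall x, 0 <= h x) ->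
  (forall i, (i < n)%N -> dominated (f i) h) ->
  dominated (fun x => \sum_(i < n) f i x) h.
Proof.
move=> h0; elim: n => [|n IH] fh.
  by under eq_fun do rewrite big_ord0; exact: dominated0.
under eq_fun do rewrite big_ord_recr/=.
by apply: dominatedD; [apply: IH => i /ltnW; exact: fh|exact: fh].
Qed.

(** The condition [liminf v (x - t) / v x >= 1] without quotients, so that it
also makes sense where [v] vanishes. *)
Definition almost_decreasing v : Prop := forall t e, 0 <= t -> 0 < e ->
  \forall x \near +oo, (1 - e) * v x <= v (x - t).

Lemma almost_decreasing_dominated v t : almost_decreasing v -> 0 <= t ->
  dominated (fun x => v (x + t)) v.
Proof.
move=> vd t0; have := vd t 2^-1 t0; rewrite invr_gt0 ltr0n => /(_ isT) h.
exists 2 => //; move: (near_pinfty_shift t h); apply: filterS => x.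
rewrite addrK; set w := v (x + t); set z := v x; move=> ?; lra.
Qed.

Definition almost_increasing f : Prop := forall t e, 0 <= t -> 0 < e ->
  \forall x \near +oo, f (x - t) <= (1 + e) * f x.

Lemma almost_increasing_dominated f t : almost_increasing f -> 0 <= t ->
  dominated (fun x => f (x - t)) f.
Proof. by move=> fi t0; exists (1 + 1) => //; exact: fi. Qed.

Lemma almost_decreasing0 f :
  (\forall x \near +oo, f x = 0) -> almost_decreasing f.
Proof.
move=> f0 t e t0 e0.
apply: filterS2 f0 (near_pinfty_shift (- t) f0) => x -> ->.
by rewrite mulr0.
Qed.

Lemma almost_decreasing_sum n (f : nat -> R -> R) :
  (forall i, almost_decreasing (f i)) ->
  almost_decreasing (fun x => \sum_(i < n) f i x).
Proof.
move=> fd t e t0 e0; elim: n => [|n IH].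
  by apply: nearW => x; rewrite !big_ord0 mulr0.
apply: filterS2 IH (fd n t e t0 e0) => x h1 h2.
by rewrite !big_ord_recr/= mulrDr lerD.
Qed.

Lemma almost_decreasingZ c f : 0 <= c -> almost_decreasing f ->
  almost_decreasing (fun x => c * f x).
Proof.
move=> c0 fd t e t0 e0; apply: filterS (fd t e t0 e0) => x h.
by rewrite mulrCA ler_wpM2l.
Qed.

(** For nonnegative functions, the relation [f = o(h)]. *)
Definition negligible f h := forall e, 0 < e ->
  \forall x \near +oo, f x <= e * h x.

Lemma negligible_dominated_trans f h v : negligible f h -> dominated h v ->
  negligible f v.
Proof.
move=> fh [C C0 hv] e e0; have eC0 : 0 < e / C by rewrite divr_gt0.
apply: filterS2 (fh _ eC0) hv => x fx hx; apply: (le_trans fx).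
by rewrite -mulrA ler_pM2l// ler_pdivrMl.
Qed.

Lemma negligible_shift f h t : negligible f h ->
  negligible (fun x => f (x + t)) (fun x => h (x + t)).
Proof. by move=> fh e e0; exact: (near_pinfty_shift t (fh e e0)). Qed.

Lemma negligible_sum n (f : nat -> R -> R) h : (forall x, 0 <= h x) ->
  (forall i, (i < n)%N -> negligible (f i) h) ->
  negligible (fun x => \sum_(i < n) f i x) h.
Proof.
move=> h0; elim: n => [|n IH] fh e e0.
  by apply: nearW => x; rewrite big_ord0 mulr_ge0// ltW.
have e2 : 0 < e / 2 by rewrite divr_gt0.
have fi i : (i < n)%N -> negligible (f i) h by move=> ?; apply: fh; exact: ltnW.
apply: filterS2 (IH fi _ e2) (fh n (ltnSn _) _ e2) => x h1 h2.
by rewrite big_ord_recr/= [e]splitr mulrDl lerD.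
Qed.

End eventual_bounds.

(** * Windows of other lengths *)

Section wide_intervals.
Context {R : realType}.
Implicit Types (V : distr R) (h : R -> R).

Lemma fine_le_prob V (S S' : set (measurableTypeR R)) :
  measurable S -> measurable S' -> S `<=` S' -> fine (V S) <= fine (V S').
Proof.
by move=> mS mS' SS'; rewrite -lee_fin !EFin_prob// le_measure// inE.
Qed.

Lemma prob_wide_interval V T a n : 0 <= T ->
  fine (V `]a, a + n%:R * T]%classic) = \sum_(i < n) loc V T (a + i%:R * T).
Proof.
move=> T0; elim: n => [|n IH].
  by rewrite mul0r addr0 big_ord0 set_itvoc0 measure0.
rewrite big_ord_recr/= -IH; apply: EFin_inj; rewrite EFinD EFin_loc.
rewrite !EFin_prob; try exact: measurable_itv.
rewrite -measureU; try exact: measurable_itv.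
  congr (V _); apply/seteqP; split => x/=; rewrite !in_itv/= -natr1.
    move=> /andP[ax xb]; have [xn|xn] := leP x (a + n%:R * T); [left|right].
      by rewrite ax.
    by rewrite /=; lra.
  have : 0 <= n%:R * T by rewrite mulr_ge0.
  move=> h [|] /andP[h1 h2]; apply/andP; split; lra.
apply/seteqP; split => x//=; rewrite !in_itv/= => -[/andP[_ h1] /andP[h2 _]].
by move: (le_lt_trans h1 h2); rewrite ltxx.
Qed.

Lemma prob_le_sum_loc V T a b : 0 < T -> exists n, forall x,
  fine (V `]x + a, x + b]%classic) <= \sum_(i < n) loc V T (x + (a + i%:R * T)).
Proof.
move=> T0; have [n nT] : exists n : nat, b - a <= n%:R * T.
  exists (Num.bound `|(b - a) / T|); rewrite -ler_pdivrMr//.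
  by rewrite (le_trans (ler_norm _))// ltW// archi_boundP.
exists n => x; under eq_bigr do rewrite addrA.
rewrite -prob_wide_interval ?(ltW T0)//.
apply: fine_le_prob; try exact: measurable_itv.
by move=> y /=; rewrite !in_itv/= => /andP[-> ?]; lra.
Qed.

(** This is how a bound on windows of length [T] is used on the windows of other
lengths that appear when a summand is displaced by a bounded amount. *)
Lemma dominated_wide V T a b h : 0 < T -> (forall x, 0 <= h x) ->
  (forall s, a <= s -> dominated (fun x => loc V T (x + s)) h) ->
  dominated (fun x => fine (V `]x + a, x + b]%classic)) h.
Proof.
move=> T0 h0 hs; have [n Hn] := prob_le_sum_loc V a b T0.
apply: (@dominated_trans _ (fun x => \sum_(i < n) loc V T (x + (a + i%:R * T)))).
  by apply: dominated_le; exact: nearW.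
apply: (@dominated_sum _ n (fun i x => loc V T (x + (a + i%:R * T)))) => // i _.
by apply: hs; rewrite ler_wpDr// mulr_ge0// ltW.
Qed.

Lemma negligible_wide V T h a b : 0 < T -> (forall x, 0 <= h x) ->
  (forall s, negligible (fun x => loc V T (x + s)) h) ->
  negligible (fun x => fine (V `]x + a, x + b]%classic)) h.
Proof.
move=> T0 h0 hs e e0; have [n Hn] := prob_le_sum_loc V a b T0.
have := @negligible_sum _ n (fun i x => loc V T (x + (a + i%:R * T))) h h0
  (fun i _ => hs _) e e0.
by apply: filterS => x; exact: le_trans.
Qed.

End wide_intervals.

(** * The classes as eventual bounds *)

Section limit_classes.
Context {R : realType}.
Implicit Types (V : distr R) (f h : R -> R) (T t e x : R).

Lemma limf_esup_lty f : (limf_esup (fun x => (f x)%:E) (+oo_R) < +oo)%E ->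
  exists C, \forall x \near +oo, f x <= C.
Proof.
move=> /ereal_inf_lt[_ [A nA <-]] supA.
have [C AC] : exists C : R, (ereal_sup [set (f x)%:E | x in A] <= C%:E)%E.
  case: (ereal_sup _) supA => [r _|//|_]; first by exists r.
  by exists 0; rewrite leNye.
exists C; apply: filterS nA => x Ax; rewrite -lee_fin (le_trans _ AC)//.
by apply: ereal_sup_ubound; exists x.
Qed.

Lemma lty_limf_esup f C : (\forall x \near +oo, f x <= C) ->
  (limf_esup (fun x => (f x)%:E) (+oo_R) < +oo)%E.
Proof.
move=> fC; apply: (@le_lt_trans _ _ C%:E); last exact: ltry.
apply: (@le_trans _ _ (ereal_sup [set (f x)%:E | x in [set x | f x <= C]])).
  by apply: ereal_inf_lbound; exists [set x | f x <= C].
by apply: ge_ereal_sup => _ [x /= fx <-]; rewrite lee_fin.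
Qed.

Lemma ge_limf_einf f (a b : R) : a < b ->
  (b%:E <= limf_einf (fun x => (f x)%:E) (+oo_R))%E ->
  \forall x \near +oo, a < f x.
Proof.
move=> ab; rewrite /limf_einf leeNr => h.
have : (limf_esup (\- (fun x => (f x)%:E)) (+oo_R) < (- a)%:E)%E.
  by apply: le_lt_trans h _; rewrite -EFinN lte_fin ltrN2.
move=> /ereal_inf_lt[_ [A nA <-]] supA.
apply: filterS nA => x Ax; rewrite -ltrN2 -lte_fin (le_lt_trans _ supA)//.
by apply: ereal_sup_ubound; exists x.
Qed.

Lemma classOSP T V : classOS T V <->
  loc_pos V T /\ dominated (loc (convol V V) T) (loc V T).
Proof.
split=> -[Vpos VV]; split=> //.
  have [C CV] := limf_esup_lty VV; exists (`|C| + 1); first exact: ltr_wpDl.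
  apply: filterS2 Vpos CV => x vx; rewrite ler_pdivrMr// => /le_trans; apply.
  by rewrite ler_wpM2r// ltW// (le_lt_trans (ler_norm C))// ltrDl.
case: VV => C C0 CV; apply: (@lty_limf_esup _ C).
by apply: filterS2 Vpos CV => x vx ?; rewrite ler_pdivrMr.
Qed.

Lemma classLP T V : classL T V <->
  [/\ loc_pos V T, almost_decreasing (loc V T) & almost_increasing (loc V T)].
Proof.
split=> [[Vpos VL]|[Vpos Vd Vi]].
  have K t e : 0 <= t -> 0 < e -> \forall x \near +oo,
      (1 - e) * loc V T x <= loc V T (x - t) <= (1 + e) * loc V T x.
    rewrite le_eqVlt => /predU1P[<-|t0] e0.
      apply: nearW => x; rewrite subr0.
      have := loc_ge0 V T x; move: (loc V T x) => v v0.
      by apply/andP; split; nra.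
    have /cvgrPdist_le/(_ _ e0) := VL t t0.
    apply: filterS2 Vpos => x vx; rewrite ler_distlC.
    by rewrite ler_pdivlMr// ler_pdivrMr.
  by split=> // t e t0 e0; apply: filterS (K t e t0 e0) => x /andP[].
split=> // t t0; apply/cvgrPdist_le => e e0.
apply: filterS3 Vpos (Vd t e (ltW t0) e0) (Vi t e (ltW t0) e0) => x vx h1 h2.
by rewrite ler_distlC ler_pdivlMr// ler_pdivrMr// h1.
Qed.

(** Division by zero gives [0], so quotients that are eventually close to [1] or
larger have positive denominators. *)
Lemma loc_almost_decreasing_pos T V : loc_almost_decreasing T V -> loc_pos V T.
Proof.
move=> /(_ _ (@ltr01 R)) /ge_limf_einf => /(_ _ ltr01).
apply: filterS => x h; rewrite lt_neqAle loc_ge0 andbT.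
apply: contraTneq h => <-.
by rewrite invr0 mulr0 ltxx.
Qed.

Lemma loc_almost_decreasingP T V :
  loc_almost_decreasing T V -> almost_decreasing (loc V T).
Proof.
move=> Vd t e; rewrite le_eqVlt => /predU1P[<- e0|t0 e0].
  by apply: nearW => x; rewrite subr0; have := loc_ge0 V T x; nra.
have e1 : 1 - e < 1 by rewrite gtrBl.
have := ge_limf_einf e1 (Vd _ t0).
apply: filterS2 (loc_almost_decreasing_pos Vd) => x vx.
by rewrite ltr_pdivlMr// => /ltW.
Qed.

Lemma negligible_wrt_le f h : (forall x, 0 <= f x) -> (forall x, 0 <= h x) ->
  negligible_wrt f h <-> forall e, 0 < e -> \forall x \near +oo, f x <= e * h x.
Proof.
move=> f0 h0; split=> [/eqoP fh e e0|fh].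
  by apply: filterS (fh e e0) => x; rewrite !ger0_norm.
apply/eqoP => e e0.
by apply: filterS (fh e e0) => x; rewrite !ger0_norm.
Qed.

Lemma weakly_equiv_dominated f h :
  (forall x, 0 <= f x) -> (forall x, 0 <= h x) ->
  weakly_equiv f h <-> dominated f h /\ dominated h f.
Proof.
have K (f' h' : R -> R^o) : (forall x, 0 <= f' x) -> (forall x, 0 <= h' x) ->
    f' =O_at_pinfty h' <-> dominated f' h'.
  move=> f0 h0; split=> [/eqOP /pinfty_ex_gt0[C C0 fh]|[C C0 fh]].
    by exists C => //; apply: filterS fh => x; rewrite !ger0_norm.
  apply/eqOP; apply: filterS (near_pinfty_gt C) => D CD.
  apply: filterS fh => x fx; rewrite !ger0_norm//.
  by rewrite (le_trans fx)// ler_wpM2r// ltW.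
move=> f0 h0; have [Kfh hKf] := K f h f0 h0; have [Khf fKh] := K h f h0 f0.
by split=> -[fh hf]; split; [exact: Kfh|exact: Khf|exact: hKf|exact: fKh].
Qed.

End limit_classes.

(** * Local bounds for a convolution *)

Section convolution_asymptotics.
Context {R : realType}.
Implicit Types (V W : distr R) (T t e x : R) (D S : set (measurableTypeR R)).

(** Events that eventually contain each point of [D] capture almost all of the
mass of [D].  This turns pointwise limits in [y] into bounds on integrals in
[y], where no uniformity in [y] is available.  Were it false, it would fail
along a sequence tending to infinity, which continuity from below forbids. *)
Lemma prob_near W D (A : R -> set (measurableTypeR R)) e :
  measurable D -> (forall x, measurable (A x)) ->
  (forall y, D y -> \forall x \near +oo, A x y) -> 0 < e ->
  \forall x \near +oo, fine (W D) - e <= fine (W (D `&` A x)).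
Proof.
move=> mD mA DA e0; apply: contrapT => nP.
have /choice[u uP] : forall n : nat, exists x, n%:R < x /\
    ~ (fine (W D) - e <= fine (W (D `&` A x))).
  move=> n; apply: contrapT => nx; apply: nP.
  exists n%:R; split; first exact: num_real.
  by move=> x nltx; apply: contrapT => Px; apply: nx; exists x.
(* The sets [B N] increase to [D], and [B N] lies in [D `&` A (u N)]. *)
pose B N := D `&` \bigcap_(n in [set n | (N <= n)%N]) A (u n).
have mB N : measurable (B N).
  by apply: measurableI => //; apply: bigcap_measurable => //; exists N => /=.
have UB : \bigcup_N B N = D.
  apply/seteqP; split => [y [N _ []]//|y Dy].
  have [M [_ MA]] := DA y Dy.
  exists (Num.bound `|M|) => //; split=> // n /= Mn; apply: MA.
  have [nu _] := uP n; apply: le_lt_trans (ler_norm M) (lt_trans _ nu).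
  by rewrite (lt_le_trans (archi_boundP (normr_ge0 M)))// ler_nat.
have homB : {homo B : n m / (n <= m)%N >-> (n <= m)%O}.
  move=> n m nm; apply/subsetPset => y [Dy yA]; split=> // k /= mk.
  by apply: yA => /=; exact: leq_trans mk.
have : W (B N) @[N --> \oo] --> (fine (W D))%:E.
  rewrite EFin_prob// -[in X in _ --> X]UB; apply: nondecreasing_cvg_mu => //.
  by rewrite UB.
move=> /fine_cvg/cvgr_gt gtB.
have [N _ gtN] : \forall N \near \oo, fine (W D) - e < fine (W (B N)).
  by apply: gtB; rewrite gtrBl.
have NB : fine (W D) - e < fine (W (B N)) by apply: gtN => /=.
have [_] := uP N; apply; apply: (le_trans (ltW NB)).
apply: fine_le_prob => //; first exact: measurableI.
by move=> y [Dy yA]; split=> //; apply: yA => /=.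
Qed.

Lemma measurable_loc_ge V T c x :
  measurable [set y : measurableTypeR R | c <= loc V T (x - (y : R))].
Proof.
have /measurable_EFinP/(_ measurableT `[c, +oo[%classic) := measurable_loc V T x.
rewrite setTI => /(_ (measurable_itv _)); congr measurable.
by apply/seteqP; split => y /=; rewrite in_itv/= andbT.
Qed.

Lemma measurable_loc_le V T c x :
  measurable [set y : measurableTypeR R | loc V T (x - (y : R)) <= c].
Proof.
have /measurable_EFinP/(_ measurableT `]-oo, c]%classic) := measurable_loc V T x.
rewrite setTI => /(_ (measurable_itv _)); exact.
Qed.

(** A summand [y >= t] moves the window from [x - t] further down, where an
almost decreasing [V] has at least as much mass; by [prob_near] this is so
for almost all such [y] at once. *)
Lemma convol_almost_ge V W T t e : almost_decreasing (loc V T) ->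
  0 <= t -> 0 < e -> e <= 1 ->
  \forall x \near +oo,
    (1 - e) * (fine (W `[t, +oo[%classic) - e) * loc V T (x - t) <=
    loc (convol W V) T x.
Proof.
move=> Vd t0 e0 e1.
pose A x := [set y : measurableTypeR R |
  (1 - e) * loc V T (x - t) <= loc V T (x - (y : R))].
have mA x : measurable (A x) by exact: measurable_loc_ge.
have DA y : `[t, +oo[%classic y -> \forall x \near +oo, A x y.
  rewrite /= in_itv/= andbT => ty.
  have yt0 : 0 <= y - t by rewrite subr_ge0.
  apply: filterS (near_pinfty_shift (- t) (Vd (y - t) e yt0 e0)) => x.
  by rewrite /A/= opprB addrA subrK.
have mD : measurable (`[t, +oo[%classic : set (measurableTypeR R)).
  exact: measurable_itv.
apply: filterS (prob_near W mD mA DA e0) => x WD.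
have b0 : 0 <= (1 - e) * loc V T (x - t) by apply: mulr_ge0; [lra|exact: loc_ge0].
have := @loc_convol_compare R V V W T T x x 0
  ((1 - e) * loc V T (x - t)) 1 0 (`[t, +oo[%classic `&` A x) set0
  (lexx _) b0 ler01 (lexx _) (measurableI _ _ mD (mA x)) measurable0.
rewrite !mul0r !add0r !addr0 !mul1r => H.
rewrite mulrAC; apply: (le_trans (ler_wpM2l b0 WD)).
apply: H => y; rewrite mul0r add0r mul0r addr0 mul1r indicE.
case: (boolP (y \in _)) => [/set_mem[_ Ay]|_]; last first.
  by rewrite mulr0; exact: loc_ge0.
by rewrite mulr1; exact: Ay.
Qed.

(** With [t = 0] this says that convolving with a nonnegative law does not make
an almost decreasing local probability smaller; with [t > 0] it controls a
shift to the left by the convolution. *)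
Lemma dominated_convol V W T t : almost_decreasing (loc V T) -> 0 <= t ->
  0 < fine (W `[t, +oo[%classic) ->
  dominated (fun x => loc V T (x - t)) (loc (convol W V) T).
Proof.
move=> Vd t0; set w := fine _ => w0.
pose e := Num.min 2^-1 (w / 2).
have e0 : 0 < e by rewrite lt_min invr_gt0 ltr0n divr_gt0.
have e12 : e <= 2^-1 by rewrite ge_min lexx.
have ew : e <= w / 2 by rewrite ge_min lexx orbT.
have e1 : e <= 1 by lra.
exists ((1 - e) * (w - e))^-1; first by rewrite invr_gt0 mulr_gt0//; lra.
apply: filterS (convol_almost_ge W Vd t0 e0 e1) => x H.
by rewrite ler_pdivlMl// mulr_gt0//; lra.
Qed.

Definition nonneg_law V : Prop := V `]-oo, 0[%classic = 0%E.

Lemma nonneg_law_loc V T x : nonneg_law V -> x + T < 0 -> loc V T x = 0.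
Proof.
rewrite /nonneg_law => V0 xT.
have : ((loc V T x)%:E <= V `]-oo, 0%R[%classic)%E.
  rewrite EFin_loc; apply: le_measure; rewrite ?inE; try exact: measurable_itv.
  by move=> y /=; rewrite !in_itv/= => /andP[_ ?]; lra.
by rewrite V0 lee_fin => ?; apply/eqP; rewrite eq_le loc_ge0 andbT.
Qed.

(** A bound on the second factor is only known far out, that is for [y <= x - B];
for the remaining [y], as [V] is nonnegative, the first factor itself has to
lie in [`]x - B, x + T]]. *)
Lemma convol_le V V' W T c : nonneg_law V -> 0 <= c ->
  (\forall x \near +oo, loc V T x <= c * loc V' T x) ->
  exists B, forall x, loc (convol W V) T x <=
    c * loc (convol W V') T x + fine (W `]x - B, x + T]%classic).
Proof.
(* The unit is added because the bound holds strictly beyond [B], whereas the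
   window [`]x - (B + 1), x + T]] is open on the left. *)
move=> V0 c0 [B [_ BV]]; exists (B + 1) => x.
have := @loc_convol_compare R V V' W T T x x 1 0 c 1 set0
  `]x - (B + 1), x + T]%classic ler01 (lexx _) c0 ler01 measurable0
  (measurable_itv _).
rewrite !mul0r !addr0 !mul1r; apply => y.
rewrite mul0r addr0 !mul1r indicE.
have v0 := loc_ge0 V' T (x - y).
have [yB|yB] := leP y (x - (B + 1)).
  have : loc V T (x - y) <= c * loc V' T (x - y) by apply: BV; lra.
  by move/le_trans; apply; rewrite ler_wpDr.
have [yT|yT] := leP y (x + T).
  rewrite mem_set/=; last by rewrite in_itv/= yB.
  by rewrite ler_wpDl ?mulr_ge0// loc_le1.
by rewrite (nonneg_law_loc V0) ?addr_ge0 ?mulr_ge0//; lra.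
Qed.

(** If the sum of two summands is asked to fall into a longer window, one of them
may be displaced by up to [K]. *)
Lemma convol_shift_ge V W T K x : 0 <= K ->
  loc V T x * fine (W `[0, K]%classic) <= loc (convol W V) (T + K) x.
Proof.
move=> K0.
have := @loc_convol_compare R V V W T (T + K) x x 0 (loc V T x) 1 0
  `[0, K]%classic set0 (lexx _) (loc_ge0 _ _ _) ler01 (lexx _)
  (measurable_itv _) measurable0.
rewrite !mul0r !add0r !addr0 !mul1r; apply => y.
rewrite mul0r add0r mul0r addr0 mul1r indicE.
case: (boolP (y \in _)) => [/set_mem|_]; last by rewrite mulr0; exact: loc_ge0.
rewrite /= in_itv/= mulr1 => /andP[y0 yK].
apply: fine_le_prob; try exact: measurable_itv.
by move=> z /=; rewrite !in_itv/= => /andP[? ?]; apply/andP; split; lra.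
Qed.

End convolution_asymptotics.

(** * Compound Poisson laws *)

Section compound_poisson_calculus.
Context {R : realType}.
Variables (m : {nonneg R}) (F : distr R).
Implicit Types (V : distr R) (S : set (measurableTypeR R)).
Local Notation p := (fun k => (poisson_weight m k)%:num).
Local Notation G := (compound_poisson m F : distr R).

Lemma poisson_weightS k : p k.+1 = m%:num / k.+1%:R * p k.
Proof.
rewrite /poisson_weight/= factS natrM exprS; field.
by rewrite nat1r !pnatr_eq0 -!lt0n fact_gt0.
Qed.

Lemma compound_poissonE S :
  (G S = \sum_(0 <= k <oo) (p k)%:E * convol_pow F k S)%E.
Proof. by []. Qed.

Lemma convol_pow1 : same_law (convol_pow F 1) F.
Proof. by move=> S mS; rewrite convolC// convol_dirac0. Qed.

Lemma convol_pow_double k :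
  same_law (convol (convol_pow F k) (convol_pow F k)) (convol_pow F (k + k)).
Proof. by move=> S mS; rewrite convol_powD. Qed.

Lemma integral_compound_poisson (f : measurableTypeR R -> \bar R) D :
  measurable D -> measurable_fun D f -> (forall x, (0 <= f x)%E) ->
  (\int[G]_(x in D) f x =
   \sum_(0 <= k <oo) (p k)%:E * \int[convol_pow F k]_(x in D) f x)%E.
Proof.
move=> mD mf f0.
rewrite (eq_measure_integral
  (mseries (fun k => mscale (poisson_weight m k) (convol_pow F k)) 0))//.
rewrite ge0_integral_measure_series//; apply: eq_eseriesr => k _.
by rewrite ge0_integral_mscale.
Qed.

Lemma convol_compound_poisson V S : measurable S ->
  (convol G V S = \sum_(0 <= k <oo) (p k)%:E * convol (convol_pow F k) V S)%E.
Proof.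
move=> mS; rewrite convolE// integral_compound_poisson//.
- by apply: eq_eseriesr => k _; rewrite convolE.
- exact: measurable_integral_indic_sum.
- by move=> x; apply: integral_ge0 => y _; rewrite lee_fin.
Qed.

(** Only the term [p 1 * F] of the compound Poisson law is kept. *)
Lemma convol_compound_poisson_ge V S : measurable S ->
  p 1%N * fine (convol F V S) <= fine (convol G V S).
Proof.
move=> mS; rewrite -lee_fin EFinM !EFin_prob// convol_compound_poisson//.
rewrite -(eq_convol convol_pow1 (fun _ _ => erefl) mS).
pose a k := ((p k)%:E * convol (convol_pow F k) V S)%E.
have a0 k : (0 <= a k)%E by rewrite mule_ge0.
apply: le_trans (nneseries_lim_ge 2 (fun n _ _ => a0 n)).
by rewrite big_nat_recr//= leeDr// big_nat1.
Qed.

Lemma compound_poisson_ge_sum S N : measurable S ->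
  \sum_(k < N) p k * fine (convol_pow F k S) <= fine (G S).
Proof.
move=> mS; rewrite -lee_fin EFin_prob// compound_poissonE.
have a0 k : (0 <= (p k)%:E * convol_pow F k S)%E by rewrite mule_ge0.
apply: le_trans (nneseries_lim_ge N (fun n _ _ => a0 n)).
rewrite big_mkord -sumEFin; apply: lee_sum => k _.
by rewrite EFinM EFin_prob.
Qed.

(** The identity [p k.+1 = m / k.+1 * p k] compares the tail of the series of
[G] with that of [F * G], whose coefficient at [F^{*k.+1}] is [p k]; the
ratio [m / k.+1] is small for large [k]. *)
Lemma compound_poisson_tail S N : measurable S ->
  fine (G S) <= \sum_(k < N.+1) p k * fine (convol_pow F k S) +
    m%:num / N.+1%:R * fine (convol F G S).
Proof.
move=> mS; pose a k := ((p k)%:E * convol_pow F k S)%E.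
pose b k := ((p k)%:E * convol_pow F k.+1 S)%E.
have a0 k : (0 <= a k)%E by rewrite mule_ge0.
have b0 k : (0 <= b k)%E by rewrite mule_ge0.
have GE : G S = (\sum_(0 <= k <oo) a k)%E by exact: compound_poissonE.
have FG : convol F G S = (\sum_(0 <= k <oo) b k)%E.
  rewrite convolC// convol_compound_poisson//; apply: eq_eseriesr => k _.
  by rewrite convolC.
rewrite -lee_fin EFinD EFinM !EFin_prob// GE FG.
rewrite (nneseries_split 0 N.+1)//= add0n big_mkord.
apply: leeD.
  by rewrite -sumEFin; apply: lee_sum => k _; rewrite EFinM EFin_prob.
rewrite -nneseries_addn//.
apply: (@le_trans _ _ ((m%:num / N.+1%:R)%:E * \sum_(0 <= k <oo) b (k + N)%N)%E).
  rewrite -nneseriesZl//.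
  apply: lee_nneseries => // k _.
  rewrite /a addnS poisson_weightS /b EFinM muleA -EFinM.
  rewrite lee_wpmul2r// lee_fin ler_wpM2r// ler_wpM2l// lef_pV2 ?posrE ?ltr0n//.
  by rewrite ler_nat ltnS leq_addl.
rewrite lee_wpmul2l// ?lee_fin ?divr_ge0// nneseries_addn//.
rewrite [leRHS](nneseries_split 0 N)//= add0n leeDr//.
exact: sume_ge0.
Qed.

End compound_poisson_calculus.

(** * Laws carried by the half-line *)

Section nonneg_laws.
Context {R : realType}.
Implicit Types (V W : distr R) (f h : R -> R) (T t e x : R).

Lemma nonneg_law_convol V W :
  nonneg_law V -> nonneg_law W -> nonneg_law (convol V W).
Proof.
rewrite /nonneg_law => V0 W0.
have mN : measurable (`]-oo, 0[%classic : set (measurableTypeR R)).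
  exact: measurable_itv.
have mI : measurable_fun setT
    (fun y : measurableTypeR R => (\1_(`]-oo, 0[) y)%:E : \bar R).
  exact/measurable_EFinP.
rewrite convolE//; apply/eqP; rewrite eq_le; apply/andP; split; last first.
  by apply: integral_ge0 => x _; apply: integral_ge0 => y _; rewrite lee_fin.
apply: (@le_trans _ _ (\int[V]_x (\1_(`]-oo, 0[) x)%:E)%E); last first.
  by rewrite integral_indic// setIT -V0.
apply: ge0_le_integral => //.
- by move=> x _; apply: integral_ge0 => y _; rewrite lee_fin.
- exact: measurable_integral_indic_sum.
move=> x _.
apply: (@le_trans _ _
  (\int[W]_y ((\1_(`]-oo, 0[) x)%:E + (\1_(`]-oo, 0[) y)%:E))%E).
  apply: ge0_le_integral => //.
  - apply/measurable_EFinP; apply: measurableT_comp => //; exact: measurable_addl.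
  - by apply: emeasurable_funD => //; exact: measurable_cst.
  move=> y _; rewrite -EFinD lee_fin !indicE.
  have [xy|] := boolP (x + y \in _); last by rewrite addr_ge0.
  have [xN|xN] := boolP (x \in _); first by rewrite lerDl.
  have [yN|yN] := boolP (y \in _); first by rewrite add0r.
  move: xN yN xy; rewrite !notin_setE inE/= !in_itv/=.
  by move=> /negP + /negP; rewrite -!leNgt => x0 y0; rewrite ltNge addr_ge0.
have W1 : (\int[W]_y (\1_(`]-oo, 0[) y)%:E = 0)%E.
  by rewrite integral_indic// setIT -W0.
rewrite ge0_integralD//= [X in (_ + X)%E]W1 adde0 integral_cst//.
by rewrite [X in (_ * X)%E](@probability_setT _ _ _ W) mule1.
Qed.

Lemma prob_dirac0 (S : set (measurableTypeR R)) :
  (Defs.dirac0 : distr R) S = (\1_S (0 : R))%:E.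
Proof. by []. Qed.

Lemma nonneg_law_dirac0 : nonneg_law (Defs.dirac0 : distr R).
Proof. by rewrite /nonneg_law prob_dirac0 indicE memNset//= in_itv/= ltxx. Qed.

Lemma nonneg_law_convol_pow V k : nonneg_law V -> nonneg_law (convol_pow V k).
Proof.
move=> V0; elim: k => [|k IH]; first exact: nonneg_law_dirac0.
exact: nonneg_law_convol.
Qed.

Lemma nonneg_law_compound_poisson m V :
  nonneg_law V -> nonneg_law (compound_poisson m V).
Proof.
move=> V0; rewrite /nonneg_law compound_poissonE eseries0// => k _ _.
by rewrite (nonneg_law_convol_pow k V0) mule0.
Qed.

Lemma loc_dirac0 T x : 0 <= x -> loc (Defs.dirac0 : distr R) T x = 0.
Proof.
by move=> x0; rewrite /loc prob_dirac0 indicE memNset//= in_itv/= ltNge x0.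
Qed.

Lemma nonneg_law_mass V : nonneg_law V -> fine (V `[0, +oo[%classic) = 1.
Proof.
rewrite /nonneg_law => V0.
have -> : `[0, +oo[%classic = ~` (`]-oo, 0[%classic : set (measurableTypeR R)).
  by rewrite setCitvl.
by rewrite probability_setC ?V0 ?sube0//; exact: measurable_itv.
Qed.

Lemma nonneg_law_bounded_mass V : nonneg_law V ->
  exists s, 0 <= s /\ 0 < fine (V `[0, s]%classic).
Proof.
move=> V0.
have mD : measurable (`[0, +oo[%classic : set (measurableTypeR R)).
  exact: measurable_itv.
have mA (x : R) : measurable (`]-oo, x]%classic : set (measurableTypeR R)).
  exact: measurable_itv.
have DA (y : R) : `[0, +oo[%classic y ->
    \forall x \near (+oo_R), (`]-oo, x]%classic : set (measurableTypeR R)) y.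
  move=> _; apply: filterS (near_pinfty_gt y) => x /ltW yx.
  by rewrite /= in_itv.
have e0 : 0 < 2^-1 :> R by rewrite invr_gt0.
have [s [s0]] : exists s, 0 <= s /\
    fine (V `[0, +oo[%classic) - 2^-1 <=
      fine (V (`[0, +oo[%classic `&` `]-oo, s]%classic)).
  have [M [_ MP]] := prob_near V mD mA DA e0.
  exists (Num.max 0 (M + 1)); split; first by rewrite le_max lexx.
  by apply: MP; rewrite lt_max ltrDl ltr01 orbT.
rewrite nonneg_law_mass// => Vs; exists s; split=> //.
suff -> : `[0, s]%classic = `[0, +oo[%classic `&` `]-oo, s]%classic :> set R by lra.
apply/seteqP; split => y /=; rewrite !in_itv/= andbT; first by move=> /andP[].
by move=> [->].
Qed.

Lemma loc_pos_tail V T t : loc_pos V T -> 0 < fine (V `[t, +oo[%classic).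
Proof.
move=> [M [_ MP]]; apply: (@lt_le_trans _ _ (loc V T (Num.max t (M + 1)))).
  by apply: MP; rewrite lt_max ltrDl ltr01 orbT.
apply: fine_le_prob; try exact: measurable_itv.
move=> y /=; rewrite !in_itv/= andbT => /andP[+ _].
by rewrite gt_max => /andP[/ltW].
Qed.

(** The local probabilities of a factor are controlled by those of the product:
the other factor lies in some bounded interval with positive probability, so
[convol_shift_ge] applies. *)
Lemma dominated_factor V W T h : 0 < T -> nonneg_law W -> (forall x, 0 <= h x) ->
  (forall s, 0 <= s -> dominated (fun x => loc (convol W V) T (x + s)) h) ->
  dominated (loc V T) h.
Proof.
move=> T0 W0 h0 hs.
have [K [K0 w0]] := nonneg_law_bounded_mass W0.
set w := fine _ in w0.
apply: (@dominated_trans _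
  (fun x => w^-1 * fine (convol W V `]x + 0, x + (T + K)]%classic))).
  apply: dominated_le; apply: nearW => x.
  rewrite ler_pdivlMl// mulrC addr0; exact: convol_shift_ge.
apply: dominatedZ => //; first by rewrite invr_ge0 ltW.
exact: (@dominated_wide R (convol W V) T 0 (T + K) h T0 h0 hs).
Qed.

End nonneg_laws.

(** * Deconvolution *)

Section deconvolution.
Context {R : realType}.
Implicit Types (V W : distr R) (f h : R -> R) (T t e x : R).

(** Let [v] and [u] be the local probabilities of [V] and [W * V], and suppose
[v (x - t) > (1 + e0) * v x] for some large [x].  Then, for most [y]
in [`[0, s]], the window of [V] at [x - t - y] has more mass than the one at
[x + s - y] by a fixed proportion of [v x]: the first lies to the left of
[x - t], the second to the right of [x], and [V] is almost decreasing.  For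
all other [y] the loss is small, again because [V] is almost decreasing, or
because [W] is negligible when [x + s - y] is not large.  Averaging over [W]
gives [u (x - t) >= u (x + s) + const * v x] up to errors of arbitrarily small
proportion, against the hypothesis on [u].  Comparing with [x + s] and not with [x] is what separates the two
windows for all [y] in [`[0, s]] at once. *)
Lemma deconvol_almost_increasing V W T :
  0 < T -> nonneg_law V -> nonneg_law W ->
  loc_pos V T -> almost_decreasing (loc V T) ->
  almost_increasing (loc (convol W V) T) ->
  dominated (loc (convol W V) T) (loc V T) ->
  dominated (loc V T) (loc (convol W V) T) ->
  negligible (loc W T) (loc V T) ->
  almost_increasing (loc V T).
Proof.
set v := loc V T; set u := loc (convol W V) T.
move=> T0 V0 W0 vpos vd ui uv vu Wv t e0 t0 e00.
have [s [s0 w0]] := nonneg_law_bounded_mass W0; set w := fine _ in w0.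
have v_ge0 x : 0 <= v x by exact: loc_ge0.
have vshift r : dominated (fun x => v (x + r)) v.
  have [r0|r0] := leP 0 r; first exact: almost_decreasing_dominated.
  apply: (@dominated_trans _ (fun x => u (x + r))); first exact: dominated_shift.
  apply: (@dominated_trans _ u) => //.
  rewrite -(opprK r); apply: almost_increasing_dominated => //.
  by rewrite oppr_ge0 ltW.
have [C C0 uC] : dominated (fun x => u (x + s)) v.
  apply: (@dominated_trans _ (fun x => v (x + s))); first exact: dominated_shift.
  exact: vshift.
(* The gain is at least [e0 * w / 8 * v x] once [eta <= 2^-1] and
   [eta <= e0 / 2], the loss at most [(2 * C + 1) * eta * v x]; the last
   constraint on [eta] makes the loss smaller. *)
pose eta := Num.min 2^-1 (Num.min (e0 / 2) (e0 * w / (16 * (2 * C + 1)))).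
have D0 : 0 < 16 * (2 * C + 1) by rewrite mulr_gt0// addr_gt0// mulr_gt0.
have eta0 : 0 < eta.
  by rewrite !lt_min invr_gt0 ltr0n !divr_gt0// mulr_gt0.
have eta2 : eta <= 2^-1 by rewrite ge_min lexx.
have etae : eta <= e0 / 2 by rewrite !ge_min lexx orbT.
have etaC : eta * (16 * (2 * C + 1)) <= e0 * w.
  by rewrite -ler_pdivlMr// !ge_min lexx !orbT.
have ts0 : 0 <= t + s by rewrite addr_ge0.
have [B [_ Bv]] := vd (t + s) eta ts0 eta0.
pose c := (1 - eta) * (e0 - eta).
pose A x := [set y : measurableTypeR R |
    (1 - eta) * v (x - t) <= v (x - t - (y : R))] `&`
  [set y : measurableTypeR R | v (x + s - (y : R)) <= (1 + eta) * v x].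
have mA x : measurable (A x).
  by apply: measurableI; [exact: measurable_loc_ge|exact: measurable_loc_le].
have mD : measurable (`[0, s]%classic : set (measurableTypeR R)).
  exact: measurable_itv.
have DA y : `[0, s]%classic y -> \forall x \near +oo, A x y.
  rewrite /= in_itv/= => /andP[y0 ys].
  have sy0 : 0 <= s - y by rewrite subr_ge0.
  (* The choice [eta / (1 + eta)] makes [1 - eta / (1 + eta) = (1 + eta)^-1]. *)
  have eta'0 : 0 < eta / (1 + eta) by rewrite divr_gt0// addr_gt0.
  apply: filterS2 (near_pinfty_shift (- t) (vd y eta y0 eta0))
    (near_pinfty_shift (s - y) (vd (s - y) _ sy0 eta'0)) => x h1 h2.
  split=> //=; move: h2; rewrite addrK addrA.
  have -> : 1 - eta / (1 + eta) = (1 + eta)^-1.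
    by apply: (mulIf (lt0r_neq0 (addr_gt0 ltr01 eta0))); field; lra.
  by rewrite ler_pdivrMl// addr_gt0.
have w20 : 0 < w / 2 by rewrite divr_gt0.
have W_neg :
    negligible (fun x => fine (W `]x + (s - B - 1), x + (s + T)]%classic)) v.
  apply: (@negligible_wide R W T v (s - B - 1) (s + T) T0 v_ge0) => r.
  exact: (negligible_dominated_trans (negligible_shift r Wv) (vshift r)).
near=> x.
rewrite leNgt; apply/negP => vx.
have vx0 : 0 < v x by near: x; exact: vpos.
have WD : w / 2 <= fine (W (`[0, s] `&` A x)).
  have : fine (W `[0, s]%classic) - w / 2 <= fine (W (`[0, s] `&` A x)).
    by near: x; exact: prob_near.
  by rewrite -/w; lra.
have ux : u (x - t) <= (1 + eta) * u (x + s).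
  have : u (x + s - (t + s)) <= (1 + eta) * u (x + s).
    by near: x; exact: (near_pinfty_shift s (ui _ _ ts0 eta0)).
  by rewrite opprD addrACA subrr addr0.
have usx : u (x + s) <= C * v x by near: x; exact: uC.
have Wx : fine (W `]x + (s - B - 1), x + (s + T)]%classic) <= eta * v x.
  by near: x; exact: W_neg.
have eta1 : 0 <= 1 - eta by rewrite subr_ge0 (le_trans eta2)// invf_le1// ler1n.
have c0 : 0 <= c.
  rewrite mulr_ge0// subr_ge0 (le_trans etae)// ler_pdivrMr//.
  by rewrite ler_peMr ?ler1n// ltW.
have := @loc_convol_compare R V V W T T (x + s) (x - t) (1 - eta) (c * v x) 1 1
  (`[0, s]%classic `&` A x) `]x + (s - B - 1), x + (s + T)]%classic
  eta1 (mulr_ge0 c0 (v_ge0 x)) ler01 ler01 (measurableI _ _ mD (mA x))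
  (measurable_itv _).
rewrite -/u !mul1r => H.
have : (1 - eta) * u (x + s) + c * v x * (w / 2) <= u (x - t) + eta * v x.
  apply: (@le_trans _ _ ((1 - eta) * u (x + s) +
    c * v x * fine (W (`[0, s] `&` A x)))).
    by rewrite lerD2l ler_wpM2l// mulr_ge0.
  apply: le_trans (_ : u (x - t) +
    fine (W `]x + (s - B - 1), x + (s + T)]%classic) <= _); last by rewrite lerD2l.
  apply: H => y; rewrite -/v mul1r !indicE.
  case: (boolP (y \in `[0, s] `&` A x)) => [/set_mem[_ [/= h1 h2]]|_].
    rewrite mulr1 (@le_trans _ _ (v (x - t - y)))//; last first.
      by rewrite lerDl.
    apply: le_trans h1.
    have h3 : (1 - eta) * v (x + s - y) <= (1 - eta) * ((1 + eta) * v x).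
      by rewrite ler_wpM2l.
    have h4 : (1 - eta) * ((1 + e0) * v x) <= (1 - eta) * v (x - t).
      by rewrite ler_wpM2l// ltW.
    apply: le_trans h4; rewrite /c; move: h3.
    set a := v (x + s - y); set b := v x; nra.
  rewrite mulr0 addr0.
  have vy := v_ge0 (x - t - y).
  have [yB|yB] := leP y (x + (s - B - 1)).
    rewrite (@le_trans _ _ (v (x - t - y)))//; last by rewrite lerDl.
    have -> : x - t - y = x + s - y - (t + s) by lra.
    by apply: Bv; lra.
  have [yT|yT] := leP y (x + (s + T)).
    rewrite mem_set/=; last by rewrite in_itv/= yB.
    have := v_ge0 (x + s - y); have : v (x + s - y) <= 1 by exact: loc_le1.
    set a := v (x + s - y); nra.
  rewrite [v (x + s - y)](nonneg_law_loc V0) ?mulr0 ?addr_ge0//; lra.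
have cw : e0 / 4 <= c by rewrite /c; nra.
have : e0 / 4 * (w / 2) * v x <= c * v x * (w / 2).
  by rewrite [leRHS]mulrAC; do 2 (apply: ler_wpM2r; first exact: ltW).
have : eta * u (x + s) <= eta * (C * v x) by rewrite ler_wpM2l// ltW.
have : eta * (16 * (2 * C + 1)) * v x <= e0 * w * v x.
  by rewrite ler_wpM2r// ltW.
have : 0 < e0 * w * v x by rewrite !mulr_gt0.
move: ux; move: (u (x - t)) (u (x + s)) (v x) => u1 u2 v1.
lra.
Unshelve. all: by end_near. Qed.

End deconvolution.

(** * The case of exponent zero *)

Section compound_poisson_factor.
Context {R : realType}.
Variables (T : R) (m : {nonneg R}) (F G1 G : distr R).
Local Notation G2 := (compound_poisson m F : distr R).
Local Notation p := (fun k => (poisson_weight m k)%:num).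
Local Notation f := (fun k => loc (convol_pow F k) T).
Local Notation g1 := (loc G1 T).
Local Notation g2 := (loc G2 T).
Local Notation g := (loc G T).
Local Notation psum := (fun N x => \sum_(k < N) p k * f k x).

Hypotheses (T0 : 0 < T) (m0 : 0 < m%:num) (F0 : nonneg_law F)
  (G10 : nonneg_law G1) (GE : same_law G (convol G1 G2))
  (GL : classL T G) (GOS : classOS T G) (G1neg : negligible g1 g2)
  (Fdecr : forall k, (1 <= k)%N -> loc_almost_decreasing T (convol_pow F k)).

Let f_decr k : almost_decreasing (f k).
Proof.
(* The law [F^{*0}] is the unit mass at [0], which no window to the right of
   [0] contains. *)
case: k => [|k]; last by apply: loc_almost_decreasingP; exact: Fdecr.
apply: almost_decreasing0; apply: filterS (near_pinfty_gt 0) => x /ltW.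
exact: loc_dirac0.
Qed.

Let f_pos k : (1 <= k)%N -> loc_pos (convol_pow F k) T.
Proof. by move=> /Fdecr; exact: loc_almost_decreasing_pos. Qed.

Let g_decr : almost_decreasing g.
Proof. by have /classLP[] := GL. Qed.

Let g_incr : almost_increasing g.
Proof. by have /classLP[] := GL. Qed.

Let p_gt0 k : 0 < p k.
Proof.
by rewrite /poisson_weight/= mulr_gt0 ?expR_gt0// divr_gt0 ?exprn_gt0.
Qed.

Let term_ge0 k x : 0 <= p k * f k x.
Proof. by rewrite mulr_ge0 ?loc_ge0// ltW. Qed.

Let G20 : nonneg_law G2. Proof. exact: nonneg_law_compound_poisson. Qed.

Let g_shift r : dominated (fun x => g (x + r)) g.
Proof.
have [r0|r0] := leP 0 r; first exact: almost_decreasing_dominated.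
rewrite -(opprK r); apply: almost_increasing_dominated => //.
by rewrite oppr_ge0 ltW.
Qed.

Let g_ge0 x : 0 <= g x. Proof. exact: loc_ge0. Qed.

Let dominated_shift_g h s : dominated h g -> dominated (fun x => h (x + s)) g.
Proof. by move=> hg; apply: dominated_trans (dominated_shift s hg) (g_shift s). Qed.

Lemma factor_dominated : dominated g2 g.
Proof.
apply: (dominated_factor T0 G10 g_ge0) => s _.
under eq_fun do rewrite -(eq_loc _ _ GE).
exact: g_shift.
Qed.

(** Removing the factor [G1] twice: [G * G = G1 * (G2 * G)] and
[G2 * G = G1 * (G2 * G2)]. *)
Lemma square_dominated : dominated (loc (convol G2 G2) T) g.
Proof.
have GG : dominated (loc (convol G G) T) g by have /classOSP[] := GOS.
have G2G : dominated (loc (convol G2 G) T) g.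
  apply: (dominated_factor T0 G10 g_ge0) => s _.
  have E : same_law (convol G1 (convol G2 G)) (convol G G).
    move=> S mS; rewrite -convolA//.
    by apply: eq_convol mS => // A mA; rewrite GE.
  under eq_fun do rewrite (eq_loc _ _ E).
  exact: dominated_shift_g.
apply: (dominated_factor T0 G10 g_ge0) => s _.
have E : same_law (convol G1 (convol G2 G2)) (convol G2 G).
  move=> S mS; rewrite -convolA// [RHS]convolC//.
  by apply: eq_convol mS => // A mA; rewrite GE.
under eq_fun do rewrite (eq_loc _ _ E).
exact: dominated_shift_g.
Qed.

Lemma psum_le x N : psum N x <= g2 x.
Proof. by apply: compound_poisson_ge_sum; exact: measurable_itv. Qed.

Lemma psum_le_psum x N N' : (N <= N')%N -> psum N x <= psum N' x.
Proof.
move=> NN'; rewrite -(subnKC NN') big_split_ord/= lerDl.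
by apply: sumr_ge0 => i _; exact: term_ge0.
Qed.

(** By [compound_poisson_tail] the remainder is at most [m / N] times the local
probability of [F * G2], and [p 1 * (F * G2) <= G2 * G2]. *)
Lemma psum_tail e : 0 < e -> exists N0, forall N, (N0 <= N)%N ->
  \forall x \near +oo, g2 x <= psum N x + e * g x.
Proof.
move=> e0; have [C C0 CP] := square_dominated.
pose M := Num.bound (m%:num * C / p 1%N / e).
have Mlt : m%:num * C / p 1%N / e < M.+1%:R.
  rewrite (lt_le_trans (archi_boundP _))//; last by rewrite ler_nat.
  do 2 (apply: divr_ge0; last exact: ltW).
  by apply: mulr_ge0 => //; exact: ltW.
exists M.+1 => N MN; apply: filterS CP => x GGx.
have mS : measurable (`]x, x + T]%classic : set (measurableTypeR R)).
  exact: measurable_itv.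
apply: (le_trans (compound_poisson_tail m F M mS)).
apply: lerD; first exact: psum_le_psum.
have FG : fine (convol F G2 `]x, x + T]%classic) <= C * g x / p 1%N.
  rewrite ler_pdivlMr// mulrC; apply: le_trans GGx.
  exact: convol_compound_poisson_ge.
apply: (@le_trans _ _ (m%:num / M.+1%:R * (C * g x / p 1%N))).
  by rewrite ler_wpM2l// divr_ge0.
rewrite [leLHS](_ : _ = m%:num * C / p 1%N / M.+1%:R * g x); last first.
  by rewrite /=; ring.
rewrite ler_wpM2r// ler_pdivrMr// -ler_pdivrMl// mulrC.
exact: ltW.
Qed.

(** Writing [G = G2 * G1] and replacing [G1] by [e * G2] far out bounds [g x] by
[e] times the local probability of [G2 * G2], which is at most [g x / 2],
plus [G2 `]x - B, x + T]].  Hence [g x <= 2 * G2 `]x - B, x + T]]; the shift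
by [B] is harmless for [g], and the remainder of [psum_tail] can be absorbed
in [g] a second time. *)
Lemma dominated_psum : exists N, dominated g (psum N).
Proof.
have [C1 C10 GG] := square_dominated.
pose e := (2 * C1)^-1.
have e0 : 0 < e by rewrite invr_gt0 mulr_gt0.
have [B HB] := convol_le G2 G10 (ltW e0) (G1neg e0).
have step1 : dominated g (fun x => fine (G2 `]x - B, x + T]%classic)).
  exists 2 => //; apply: filterS GG => x GGx.
  have gx : g x = loc (convol G2 G1) T x.
    by rewrite (eq_loc _ _ GE); apply: eq_loc => S mS; rewrite convolC.
  have := HB x; rewrite -gx.
  have : e * loc (convol G2 G2) T x <= 2^-1 * g x.
    have eC1 : e * C1 = 2^-1 by rewrite /e; field; rewrite gt_eqF.
    by rewrite -eC1 -mulrA ler_wpM2l// ltW.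
  set z := fine _; set y := loc (convol G2 G2) T x; set w := g x; lra.
have [n Hn] := prob_le_sum_loc G2 (- B) T T0.
have [C C0 gC] : dominated g (fun x => \sum_(i < n) g2 (x + i%:R * T)).
  apply: (@dominated_trans _ (fun x => g (x + B))).
    by have := dominated_shift B (g_shift (- B)); under eq_fun do rewrite addrK.
  apply: dominated_trans (dominated_shift B step1) _.
  apply: dominated_le; apply: nearW => x; apply: le_trans (Hn (x + B)) _.
  by under eq_bigr do rewrite addrA addrK.
have [C' C'0 gC'] : dominated (fun x => \sum_(i < n) g (x + i%:R * T)) g.
  exact: (@dominated_sum _ n (fun i x => g (x + i%:R * T))).
(* This makes the remainder [C * d * C' * g x] equal to half of [g x]. *)
pose d := (2 * C * C')^-1.
have d0 : 0 < d by rewrite invr_gt0 !mulr_gt0.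
have [N HN] := psum_tail d0; exists N.
have {}HN := HN N (leqnn N).
have gpsum : dominated g (fun x => \sum_(i < n) psum N (x + i%:R * T)).
  exists (2 * C); first exact: mulr_gt0.
  have tail : \forall x \near +oo, \sum_(i < n) g2 (x + i%:R * T) <=
      \sum_(i < n) psum N (x + i%:R * T) + d * \sum_(i < n) g (x + i%:R * T).
    elim: (n) => [|k IH]; first by apply: nearW => x; rewrite !big_ord0; lra.
    apply: filterS2 IH (near_pinfty_shift (k%:R * T) HN) => x h1 h2.
    by rewrite !big_ord_recr/= mulrDr addrACA lerD.
  apply: filterS3 gC gC' tail => x h1 h2 h3.
  have h4 : C * (d * \sum_(i < n) g (x + i%:R * T)) <= 2^-1 * g x.
    apply: (@le_trans _ _ (C * (d * (C' * g x)))).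
      by rewrite !ler_wpM2l// ltW.
    rewrite /d le_eqVlt; apply/orP; left; apply/eqP; field.
    by rewrite !gt_eqF.
  have h5 := le_trans h1 (ler_wpM2l (ltW C0) h3).
  move: h4 h5; set z := g x.
  set a := \sum_(i < n) _; set b := \sum_(i < n) _; lra.
apply: dominated_trans gpsum _.
have psum0 x : 0 <= psum N x by apply: sumr_ge0 => k _; exact: term_ge0.
apply: (@dominated_sum _ n (fun i x => psum N (x + i%:R * T))) => // i _.
apply: almost_decreasing_dominated; last by rewrite mulr_ge0// ltW.
apply: (@almost_decreasing_sum _ N (fun k x => p k * f k x)) => k.
by apply: almost_decreasingZ => //; exact/ltW.
Qed.

Lemma convol_pow_dominated_factor k : dominated (f k) g2.
Proof.
exists (p k)^-1; first by rewrite invr_gt0.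
apply: nearW => x; rewrite ler_pdivlMl//.
apply: le_trans (psum_le x k.+1); rewrite big_ord_recr/= lerDr.
by apply: sumr_ge0 => i _; exact: term_ge0.
Qed.

Lemma convol_pow_dominated k n : (1 <= k <= n)%N -> dominated (f k) (f n).
Proof.
move=> /andP[k1 kn].
have E : same_law (convol_pow F n) (convol (convol_pow F (n - k)) (convol_pow F k)).
  by move=> S mS; rewrite -convol_powD// subnK.
have := @dominated_convol R (convol_pow F k) (convol_pow F (n - k)) T 0
  (f_decr k) (lexx _).
rewrite nonneg_law_mass ?ltr01//; last exact: nonneg_law_convol_pow.
move=> /(_ isT); under eq_fun do rewrite subr0.
by congr dominated; apply/funext => x; apply/esym/eq_loc.
Qed.

Lemma dominated_convol_pow : exists n0, (1 <= n0)%N /\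
  forall n, (n0 <= n)%N -> dominated g (f n).
Proof.
have [N gN] := dominated_psum; exists N.+1; split=> // n Nn.
apply: dominated_trans gN _.
apply: (@dominated_sum _ N (fun k x => p k * f k x)) => // k kN.
apply: dominatedZ => //.
case: k kN => [|k kN]; last first.
  by apply: convol_pow_dominated => /=; exact: leq_trans (ltnW kN) (ltnW Nn).
move=> _; apply: dominated_le; apply: filterS (near_pinfty_gt 0) => x /ltW x0.
by rewrite loc_dirac0//; exact: loc_ge0.
Qed.

Lemma dominated_by_factor : dominated g g2.
Proof.
have [n [_ gn]] := dominated_convol_pow.
exact: dominated_trans (gn n (leqnn n)) (convol_pow_dominated_factor n).
Qed.

Let psum_ge e : 0 < e -> exists N0, forall N, (N0 <= N)%N ->
  \forall x \near +oo, (1 - e) * g2 x <= psum N x.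
Proof.
move=> e0; have [C C0 CP] := dominated_by_factor.
have eC0 : 0 < e / C by rewrite divr_gt0.
have [N0 HN] := psum_tail eC0; exists N0 => N NN.
apply: filterS2 CP (HN N NN) => x gx hx.
have : e / C * g x <= e / C * (C * g2 x) by rewrite ler_wpM2l// ltW.
rewrite mulrA divfK ?gt_eqF//; move: hx.
set a := g x; set b := g2 x; set c := \sum_(_ < _) _; lra.
Qed.

Let psum_decr N : almost_decreasing (psum N).
Proof.
apply: (@almost_decreasing_sum _ N (fun k x => p k * f k x)) => k.
by apply: almost_decreasingZ => //; exact/ltW.
Qed.

(** Each partial sum is almost decreasing, as a finite sum, and the partial sums
approximate [g2] in proportion. *)
Lemma factor_almost_decreasing : almost_decreasing g2.
Proof.
move=> t e t0 e0.
have e20 : 0 < e / 2 by rewrite divr_gt0.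
have [e1|e1] := leP 1 e.
  apply: nearW => x; apply: (@le_trans _ _ 0); last exact: loc_ge0.
  by apply: mulr_le0_ge0; [lra|exact: loc_ge0].
have [N HN] := psum_ge e20.
apply: filterS2 (HN N (leqnn N)) (@psum_decr N t _ t0 e20) => x h1 h2.
apply: le_trans (psum_le _ N); apply: le_trans h2.
have : (1 - e / 2) * ((1 - e / 2) * g2 x) <= (1 - e / 2) * psum N x.
  by rewrite ler_wpM2l//; lra.
apply: le_trans; have := loc_ge0 G2 T x; set z := g2 x; nra.
Qed.

Lemma factor_pos : loc_pos G2 T.
Proof.
have [C C0 CP] := dominated_by_factor.
have gpos : loc_pos G T by case: GL.
apply: filterS2 gpos CP => x gx hx.
by have := lt_le_trans gx hx; rewrite pmulr_rgt0.
Qed.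

Lemma factor_classL : classL T G2.
Proof.
apply/classLP; split.
- exact: factor_pos.
- exact: factor_almost_decreasing.
have E : loc (convol G1 G2) T = g by apply/funext => x; apply/esym/eq_loc.
apply: (deconvol_almost_increasing T0 G20 G10) => //.
- exact: factor_pos.
- exact: factor_almost_decreasing.
- by rewrite E.
- by rewrite E; exact: dominated_by_factor.
- by rewrite E; exact: factor_dominated.
Qed.

Lemma factor_classOS : classOS T G2.
Proof.
apply/classOSP; split; first exact: factor_pos.
exact: dominated_trans square_dominated dominated_by_factor.
Qed.

(** All the differences [f j (x - t) - (1 - eta) * f j x] with [j < N] are
nonnegative for large [x], so the one with [j = k], weighted by [p k], is at
most their weighted sum; this sum is [O(eta) * g2 x] since [G2] is
long-tailed. *)
Lemma convol_pow_almost_increasing k : (1 <= k)%N -> dominated g2 (f k) ->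
  almost_increasing (f k).
Proof.
move=> k1 [D D0 DP] t e t0 e0.
pose eta := Num.min 2^-1 (e * p k / (3 * D)).
have pk := p_gt0 k.
have D30 : 0 < 3 * D by rewrite mulr_gt0.
have eta0 : 0 < eta by rewrite lt_min invr_gt0 ltr0n divr_gt0// mulr_gt0.
have eta2 : eta <= 2^-1 by rewrite ge_min lexx.
have etaD : eta * (3 * D) <= e * p k by rewrite -ler_pdivlMr// ge_min lexx orbT.
have [N0 HN] := psum_ge eta0.
pose N := maxn N0 k.+1.
have kN : (k < N)%N by rewrite leq_max ltnSn orbT.
have /classLP[_ _ g2i] := factor_classL.
have {}HN := HN N (leq_maxl _ _).
have one_term : \forall x \near +oo,
    p k * (f k (x - t) - (1 - eta) * f k x) <=
    psum N (x - t) - (1 - eta) * psum N x.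
  have terms : \forall x \near +oo, forall j : 'I_N,
      (1 - eta) * f j x <= f j (x - t).
    by apply: filter_forall => j; exact: f_decr.
  apply: filterS terms => x h.
  rewrite mulr_sumr -sumrB (bigD1 (Ordinal kN))//=.
  rewrite mulrBr [X in _ - X <= _]mulrCA.
  rewrite lerDl; apply: sumr_ge0 => j _.
  rewrite [leRHS](_ : _ = p j * (f j (x - t) - (1 - eta) * f j x)).
    by apply: mulr_ge0; [exact/ltW/p_gt0|rewrite subr_ge0].
  by rewrite /=; ring.
have g2t := g2i t eta t0 eta0.
near=> x.
have h1 : p k * (f k (x - t) - (1 - eta) * f k x) <=
  psum N (x - t) - (1 - eta) * psum N x by near: x.
have h2 : (1 - eta) * g2 x <= psum N x by near: x.
have h3 : g2 (x - t) <= (1 + eta) * g2 x by near: x.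
have h4 : g2 x <= D * f k x by near: x.
have h5 := psum_le (x - t) N.
have h6 : (1 - eta) * ((1 - eta) * g2 x) <= (1 - eta) * psum N x.
  by rewrite ler_wpM2l//; lra.
have z0 := loc_ge0 G2 T x; have y0 := loc_ge0 (convol_pow F k) T x.
rewrite -(ler_pM2l pk).
have h7 : eta * g2 x <= eta * (D * f k x) by rewrite ler_wpM2l// ltW.
have h8 : eta * (3 * D) * f k x <= e * p k * f k x by rewrite ler_wpM2r.
have h9 : 0 <= p k * eta * f k x.
  by apply: mulr_ge0 => //; apply: mulr_ge0; exact: ltW.
have h10 : 0 <= eta ^+ 2 * g2 x by rewrite mulr_ge0 ?sqr_ge0.
move: h1 h2 h3 h5 h6 h7 h8 h9 h10; clear.
move: (psum N (x - t)) (psum N x) (g2 (x - t)) (g2 x) (f k (x - t)) (f k x).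
move: (p k) => *; lra.
Unshelve. all: by end_near. Qed.

(** The square of [F^{*k}] is [F^{*(k + k)}], whose local probability is [O(g2)]
like that of every convolution power. *)
Lemma convol_pow_classes k : (1 <= k)%N -> dominated g2 (f k) ->
  classL T (convol_pow F k) /\ classOS T (convol_pow F k).
Proof.
move=> k1 g2f; split.
  apply/classLP; split; [exact: f_pos|exact: f_decr|].
  exact: convol_pow_almost_increasing.
apply/classOSP; split; first exact: f_pos.
apply: dominated_trans g2f.
have -> : loc (convol (convol_pow F k) (convol_pow F k)) T = f (k + k)%N.
  by apply/funext => x; apply: eq_loc; exact: convol_pow_double.
exact: convol_pow_dominated_factor.
Qed.

Lemma convol_pow_classes_eventually : exists n0, (1 <= n0)%N /\
  forall n, (n0 <= n)%N -> classL T (convol_pow F n) /\ classOS T (convol_pow F n).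
Proof.
have [n0 [n01 gn]] := dominated_convol_pow; exists n0; split=> // n n0n.
apply: convol_pow_classes; first exact: leq_trans n0n.
exact: dominated_trans factor_dominated (gn _ n0n).
Qed.

(** For [t < 0] the window is moved to the left, and [dominated_convol] bounds
[f l (x + t)] by the local probability of [F^{*l} * F^{*l}]. *)
Lemma classOS_dominated_shift l t : (1 <= l)%N -> classOS T (convol_pow F l) ->
  dominated (fun x => f l (x + t)) (f l).
Proof.
move=> l1 /classOSP[_ OS].
have [t0|t0] := leP 0 t; first exact: almost_decreasing_dominated.
apply: dominated_trans OS; rewrite -(opprK t).
apply: dominated_convol => //; first by rewrite oppr_ge0 ltW.
exact: loc_pos_tail (f_pos l1).
Qed.

(** Induction on [j]: by [convol_le], replacing [F^{*(j.+1 * l)}] by a multiple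
of [F^{*l}] in [F^{*l} * F^{*(j.+1 * l)}] costs a window around [x] of
bounded width, which [classOS_dominated_shift] controls. *)
Lemma classOS_dominated_mul l j : (1 <= l)%N -> classOS T (convol_pow F l) ->
  dominated (f (j.+1 * l)%N) (f l).
Proof.
move=> l1 OSl; have /classOSP[_ OS] := OSl.
elim: j => [|j [C C0 IH]]; first by rewrite mul1n; exact: dominated_refl.
have F0l k : nonneg_law (convol_pow F k) by exact: nonneg_law_convol_pow.
have [B HB] := convol_le (convol_pow F l) (F0l _) (ltW C0) IH.
apply: (@dominated_trans _ (fun x =>
  C * loc (convol (convol_pow F l) (convol_pow F l)) T x +
  fine (convol_pow F l `]x + (- B), x + T]%classic))).
  apply: dominated_le; apply: nearW => x; apply: le_trans (HB x).
  rewrite le_eqVlt; apply/orP; left; apply/eqP; apply: eq_loc => S mS.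
  by rewrite mulSn convol_powD.
apply: dominatedD.
  apply: dominatedZ => //; exact: ltW.
apply: (@dominated_wide R (convol_pow F l) T (- B) T (f l) T0) => [x|s _].
  exact: loc_ge0.
exact: classOS_dominated_shift.
Qed.

(** With [n0] from [dominated_convol_pow], the chain
[g2 = O(f (n0 * l)) = O(f l) = O(f n)] gives what [convol_pow_classes] asks. *)
Lemma classOS_convol_pow_classes l : (1 <= l)%N -> classOS T (convol_pow F l) ->
  forall n, (l <= n)%N -> classL T (convol_pow F n) /\ classOS T (convol_pow F n).
Proof.
move=> l1 OSl n ln; apply: convol_pow_classes; first exact: leq_trans ln.
have [n0 [n01 gn]] := dominated_convol_pow.
apply: (@dominated_trans _ (f (n0 * l)%N)).
  apply: dominated_trans factor_dominated (gn _ _).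
  exact: leq_pmulr.
apply: (@dominated_trans _ (f l)).
  by rewrite -(prednK n01); exact: classOS_dominated_mul.
by apply: convol_pow_dominated; rewrite l1.
Qed.

End compound_poisson_factor.

(** * The Esscher transform as a homomorphism *)

Lemma mnormalizeE d (X : measurableType d) (R : realType)
    (mu : {measure set X -> \bar R}) (P : probability X R) S :
  (0 < mu setT)%E -> (mu setT < +oo)%E ->
  mnormalize mu P S = (mu S * ((fine (mu setT))^-1)%:E)%E.
Proof. by move=> h0 hoo; rewrite /mnormalize gt_eqF// lt_eqF. Qed.

Section esscher_calculus.
Context {R : realType}.
Variable g : R.
Hypothesis g0 : 0 <= g.
Implicit Types (V W : distr R) (S : set (measurableTypeR R)) (T x : R).
Local Notation E V := (esscher V g : distr R).
Local Notation M V := (fine (moment V g)).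

Let ex (y : measurableTypeR R) : \bar R := (expR (g * (y : R)))%:E.

Let measurable_ex (D : set (measurableTypeR R)) : measurable_fun D ex.
Proof.
apply/measurable_EFinP; apply: (@measurable_funTS _ _ R R).
by apply: measurableT_comp => //; exact: mulrl_measurable.
Qed.

Let ex_ge0 y : (0 <= ex y)%E. Proof. by rewrite lee_fin expR_ge0. Qed.

Let measurable_half : measurable (`[0, +oo[%classic : set (measurableTypeR R)).
Proof. exact: measurable_itv. Qed.

Lemma eq_tilt V W S : same_law V W -> measurable S -> tilt V g S = tilt W g S.
Proof. by move=> VW mS; apply: eq_measure_integral => A mA _; exact: VW. Qed.

Lemma eq_moment V W : same_law V W -> moment V g = moment W g.
Proof. by move=> VW; apply: eq_measure_integral => A mA _; exact: VW. Qed.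

Lemma tilt_setT V : tilt V g setT = moment V g.
Proof. by rewrite /tilt setTI. Qed.

(** A nonnegative law does not charge the negative half-line; integrating over
the whole line makes multiplicativity visible. *)
Lemma tiltE V S : nonneg_law V -> measurable S ->
  (tilt V g S = \int[V]_y (ex y * (\1_S y)%:E))%E.
Proof.
move=> V0 mS.
have -> : (\int[V]_y (ex y * (\1_S y)%:E) = \int[V]_(y in S) ex y)%E.
  rewrite [RHS]integral_mkcond; apply: eq_integral => y _.
  by rewrite patchE indicE; case: ifPn => _; rewrite ?mule1 ?mule0.
have mN : measurable (`]-oo, 0[%classic : set (measurableTypeR R)).
  exact: measurable_itv.
rewrite [RHS](ge0_negligible_integral mN mS (@measurable_ex S)
  (fun y _ => ex_ge0 y) V0).
by rewrite /tilt setDE setCitvl.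
Qed.

Lemma moment_ge1 V : nonneg_law V -> (1 <= moment V g)%E.
Proof.
move=> V0; apply: (@le_trans _ _ (\int[V]_(y in `[0%R, +oo[) 1)%E).
  by rewrite integral_cst//= mul1e -EFin_prob// nonneg_law_mass.
apply: ge0_le_integral => // y.
rewrite /= in_itv/= andbT => y0.
by rewrite lee_fin -expR0 ler_expR mulr_ge0.
Qed.

Lemma moment_gt0 V : nonneg_law V -> (0 < moment V g)%E.
Proof. by move=> /moment_ge1; apply: lt_le_trans; rewrite lte_fin. Qed.

Lemma fine_moment_gt0 V : nonneg_law V -> (moment V g < +oo)%E -> 0 < M V.
Proof. by move=> V0 Vfin; rewrite fine_gt0// moment_gt0. Qed.

Lemma EFin_moment V : nonneg_law V -> (moment V g < +oo)%E -> (M V)%:E = moment V g.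
Proof. by move=> V0 Vfin; rewrite fineK// ge0_fin_numE// ltW// moment_gt0. Qed.

Lemma tilt_esscher V S : nonneg_law V -> (moment V g < +oo)%E ->
  tilt V g S = ((M V)%:E * E V S)%E.
Proof.
move=> V0 Vfin.
have -> : (E V S = tilt V g S * ((M V)^-1)%:E)%E.
  rewrite -(tilt_setT V); apply: (@mnormalizeE _ _ _ (tilt V g) V S).
    by rewrite [X in (0 < X)%E](tilt_setT V); exact: moment_gt0.
  by rewrite [X in (X < _)%E](tilt_setT V).
rewrite muleCA -EFinM divff ?mule1//.
by rewrite gt_eqF// fine_moment_gt0.
Qed.

Lemma eq_esscher V W : nonneg_law V -> (moment V g < +oo)%E ->
  same_law V W -> same_law (E V) (E W).
Proof.
move=> V0 Vfin VW S mS.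
have W0 : nonneg_law W by rewrite /nonneg_law -VW//; exact: measurable_itv.
have Wfin : (moment W g < +oo)%E by rewrite -(eq_moment VW).
have := eq_tilt VW mS; rewrite !tilt_esscher// (eq_moment VW).
have M0 := fine_moment_gt0 W0 Wfin.
move=> /(congr1 (mule (M W)^-1%:E)).
by rewrite !muleA -!EFinM mulVf ?gt_eqF// !mul1e.
Qed.

Lemma nonneg_law_esscher V : nonneg_law V -> (moment V g < +oo)%E ->
  nonneg_law (E V).
Proof.
move=> V0 Vfin; have := tilt_esscher `]-oo, 0[%classic V0 Vfin.
rewrite {1}/tilt (_ : _ `&` _ = set0); last first.
  apply/seteqP; split => y//=; rewrite !in_itv/= andbT => -[h1 h2].
  by move: (lt_le_trans h1 h2); rewrite ltxx.
rewrite integral_set0 => /esym/eqP; rewrite mule_eq0 => /orP[|/eqP//].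
by rewrite eqe gt_eqF// fine_moment_gt0.
Qed.

Let measurable_kernel S : measurable S ->
  measurable_fun setT (fun z : measurableTypeR R * measurableTypeR R =>
    (ex z.2 * (\1_S (z.1 + z.2)%R)%:E)%E).
Proof.
move=> mS; apply: emeasurable_funM; last exact: measurable_indic_sum.
by apply: measurableT_comp => //; exact: measurable_ex.
Qed.

Let kernel_ge0 S (z : measurableTypeR R * measurableTypeR R) :
  (0 <= ex z.2 * (\1_S (z.1 + z.2)%R)%:E)%E.
Proof. by rewrite mule_ge0. Qed.

Lemma integral_tilt_shift V S (x : R) : nonneg_law V -> (moment V g < +oo)%E ->
  measurable S ->
  ((M V)%:E * \int[E V]_y (\1_S ((x : R) + (y : R))%R)%:E =
   \int[V]_y (ex y * (\1_S ((x : R) + (y : R))%R)%:E))%E.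
Proof.
move=> V0 Vfin mS.
pose S' := (fun y : measurableTypeR R => x + (y : R) : measurableTypeR R) @^-1` S.
have mS' : measurable S'.
  by have := measurable_addl x measurableT mS; rewrite setTI.
have -> : (\int[E V]_y (\1_S (x + (y : R))%R)%:E = E V S')%E.
  by rewrite -(setIT S') -integral_indic.
by rewrite -tilt_esscher// tiltE.
Qed.

(** The reason is [expR (g * (x + y)) = expR (g * x) * expR (g * y)].  Applying
the Tonelli theorem between the two changes of measure reduces each of them
to the value of [esscher V g] on one set, so that no change of variables
formula for general integrands is involved. *)
Lemma tilt_convol V W S : nonneg_law V -> (moment V g < +oo)%E ->
  nonneg_law W -> (moment W g < +oo)%E -> measurable S ->
  tilt (convol V W) g S = ((M V * M W)%:E * convol (E V) (E W) S)%E.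
Proof.
move=> V0 Vfin W0 Wfin mS.
rewrite tiltE//; last exact: nonneg_law_convol.
rewrite integral_convol; last 2 first.
- by apply: emeasurable_funM; [exact: measurable_ex|exact/measurable_EFinP].
- by move=> x; rewrite mule_ge0.
have MV := fine_moment_gt0 V0 Vfin; have MW := fine_moment_gt0 W0 Wfin.
rewrite convolE// EFinM -muleA.
rewrite -ge0_integralZl//; last 3 first.
- exact: measurable_integral_indic_sum.
- by move=> x _; apply: integral_ge0 => y _; rewrite lee_fin.
- by rewrite lee_fin ltW.
under [X in (_ = _ * X)%E]eq_integral do rewrite integral_tilt_shift//.
rewrite (fubini_tonelli _ (measurable_kernel mS) (kernel_ge0 S))/=.
pose h (z : measurableTypeR R * measurableTypeR R) : \bar R :=
  (ex (z.1 + z.2)%R * (\1_S (z.1 + z.2)%R)%:E)%E.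
have mh : measurable_fun setT h.
  apply: emeasurable_funM; last exact: measurable_indic_sum.
  apply: measurableT_comp; first exact: measurable_ex.
  exact: measurable_sum_pair.
have h0 z : (0 <= h z)%E by rewrite mule_ge0.
have mind (y : measurableTypeR R) : measurable_fun setT
    (fun x : measurableTypeR R => (\1_S ((y : R) + (x : R))%R)%:E : \bar R).
  by apply/measurable_EFinP; apply: measurableT_comp => //; exact: measurable_addl.
have mind' (y : measurableTypeR R) : measurable_fun setT
    (fun x : measurableTypeR R => (\1_S ((x : R) + (y : R))%R)%:E : \bar R).
  by under eq_fun do rewrite addrC; exact: mind.
transitivity (\int[W]_y \int[V]_x h (x, y))%E.
  exact: (fubini_tonelli _ mh h0).
rewrite -ge0_integralZl//; last 3 first.
- exact: (measurable_fun_fubini_tonelli_G _ (measurable_kernel mS) (kernel_ge0 S)).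
- by move=> y _; apply: integral_ge0 => x _; exact: (kernel_ge0 S (x, y)).
- by rewrite lee_fin ltW.
apply: eq_integral => y _.
rewrite ge0_integralZl//.
under [X in (_ = _ * (_ * X))%E]eq_integral do rewrite addrC.
rewrite muleCA integral_tilt_shift// -ge0_integralZl//; last 2 first.
- by apply: emeasurable_funM; [exact: measurable_ex|exact: mind].
- by move=> x _; rewrite mule_ge0.
apply: eq_integral => x _.
rewrite /h/= muleA (addrC (x : R)); congr (_ * _)%E.
by rewrite /ex -EFinM -expRD -mulrDr.
Qed.

Lemma moment_convol V W : nonneg_law V -> nonneg_law W ->
  moment (convol V W) g = (moment V g * moment W g)%E.
Proof.
move=> V0 W0; have VW0 := nonneg_law_convol V0 W0.
have E' (U : distr R) : nonneg_law U -> moment U g = (\int[U]_y ex y)%E.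
  move=> U0; rewrite -tilt_setT tiltE//.
  by apply: eq_integral => y _; rewrite indicT mule1.
have W1 := moment_gt0 W0.
rewrite E'// integral_convol//.
have inner (x : R) : (\int[W]_y ex (x + (y : R))%R = ex x * moment W g)%E.
  rewrite E'// -ge0_integralZl//.
  by apply: eq_integral => y _; rewrite /ex mulrDr expRD EFinM.
under eq_integral do rewrite inner.
by rewrite ge0_integralZr//; [rewrite -E'|exact: ltW].
Qed.

Lemma moment_dirac0 : moment (Defs.dirac0 : distr R) g = 1%E.
Proof.
rewrite -tilt_setT tiltE//; last exact: nonneg_law_dirac0.
rewrite /Defs.dirac0 integral_dirac//.
  by rewrite diracT mul1e /ex mulr0 expR0 indicT mule1.
by apply: emeasurable_funM; [exact: measurable_ex|exact/measurable_EFinP].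
Qed.

Lemma moment_convol_pow V k : nonneg_law V -> (moment V g < +oo)%E ->
  moment (convol_pow V k) g = (M V ^+ k)%:E.
Proof.
move=> V0 Vfin; elim: k => [|k IH]; first by rewrite expr0 moment_dirac0.
rewrite moment_convol//; last exact: nonneg_law_convol_pow.
by rewrite IH exprS EFinM EFin_moment.
Qed.

Lemma esscher_convol V W : nonneg_law V -> (moment V g < +oo)%E ->
  nonneg_law W -> (moment W g < +oo)%E ->
  same_law (E (convol V W)) (convol (E V) (E W)).
Proof.
move=> V0 Vfin W0 Wfin S mS.
have VW0 := nonneg_law_convol V0 W0.
have VWfin : (moment (convol V W) g < +oo)%E.
  by rewrite moment_convol// -EFin_moment// -(EFin_moment W0)// -EFinM ltry.
have := tilt_convol V0 Vfin W0 Wfin mS; rewrite tilt_esscher//.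
rewrite moment_convol// -EFin_moment// -(EFin_moment W0)// -EFinM /=.
have c0 : 0 < M V * M W by rewrite mulr_gt0// fine_moment_gt0.
move=> /(congr1 (mule (M V * M W)^-1%:E)).
by rewrite !muleA -!EFinM mulVf ?gt_eqF// !mul1e.
Qed.

Lemma moment_convol_pow_lty V k : nonneg_law V -> (moment V g < +oo)%E ->
  (moment (convol_pow V k) g < +oo)%E.
Proof. by move=> V0 Vfin; rewrite moment_convol_pow// ltry. Qed.

Lemma esscher_convol_pow V k : nonneg_law V -> (moment V g < +oo)%E ->
  same_law (E (convol_pow V k)) (convol_pow (E V) k).
Proof.
move=> V0 Vfin; elim: k => [|k IH] S mS.
  have d0 : nonneg_law (Defs.dirac0 : distr R) by exact: nonneg_law_dirac0.
  have dfin : (moment (Defs.dirac0 : distr R) g < +oo)%E.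
    by rewrite moment_dirac0 ltry.
  have := tilt_esscher S d0 dfin; rewrite moment_dirac0 mul1e => <-.
  rewrite tiltE// /Defs.dirac0 integral_dirac//.
    by rewrite diracT mul1e /ex mulr0 expR0 mul1e.
  by apply: emeasurable_funM; [exact: measurable_ex|exact/measurable_EFinP].
rewrite esscher_convol//; first exact: eq_convol.
  exact: nonneg_law_convol_pow.
exact: moment_convol_pow_lty.
Qed.

(** The series for the moment contains the term of index [1]. *)
Lemma moment_compound_poisson_lty (m : {nonneg R}) V : 0 < m%:num ->
  nonneg_law V -> (moment (compound_poisson m V) g < +oo)%E ->
  (moment V g < +oo)%E.
Proof.
move=> m0 V0 Gfin.
pose a k := ((poisson_weight m k)%:num%:E * moment (convol_pow V k) g)%E.
have a0 k : (0 <= a k)%E.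
  by rewrite mule_ge0// ltW// moment_gt0//; exact: nonneg_law_convol_pow.
have afin : (\sum_(0 <= k <oo) a k < +oo)%E.
  by move: Gfin; rewrite {1}/moment integral_compound_poisson.
have a1fin : (a 1%N < +oo)%E.
  apply: le_lt_trans afin.
  apply: le_trans (nneseries_lim_ge 2 (fun n _ _ => a0 n)).
  by rewrite big_nat_recr//= leeDr// big_nat1.
have p0 : 0 < (poisson_weight m 1)%:num.
  by rewrite /poisson_weight/= mulr_gt0 ?expR_gt0// divr_gt0 ?exprn_gt0// ltr0n.
rewrite ltNge leye_eq; apply/eqP => Voo; move: a1fin.
by rewrite /a (eq_moment (convol_pow1 V)) Voo gt0_muley ?lte_fin// ltxx.
Qed.

(** The factor [M V ^+ k] of the [k]-th term is absorbed by the intensity, and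
the remaining constant by the normalization. *)
Lemma esscher_compound_poisson (m m' : {nonneg R}) V :
  nonneg_law V -> (moment V g < +oo)%E -> m'%:num = m%:num * M V ->
  (moment (compound_poisson m V) g < +oo)%E /\
  same_law (E (compound_poisson m V)) (compound_poisson m' (E V)).
Proof.
(* The ratio of the normalizing constants of the two Poisson laws. *)
move=> V0 Vfin mm'; pose c := expR (m'%:num - m%:num).
have tiltG S : measurable S ->
    tilt (compound_poisson m V) g S = (c%:E * compound_poisson m' (E V) S)%E.
  move=> mS; rewrite /tilt integral_compound_poisson//; last first.
    exact: measurableI.
  rewrite compound_poissonE -nneseriesZl//; last by move=> k _; rewrite mule_ge0.
  apply: eq_eseriesr => k _.
  rewrite -[X in (_ * X)%E]/(tilt (convol_pow V k) g S) tilt_esscher; last 2 first.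
  - exact: nonneg_law_convol_pow.
  - exact: moment_convol_pow_lty.
  rewrite (esscher_convol_pow k V0 Vfin mS) moment_convol_pow//= !muleA -!EFinM.
  congr (_%:E * _)%E; rewrite mm' exprMn /c expRD -mm'.
  rewrite (mulrC (expR m'%:num)) -!mulrA (mulrA (expR m'%:num)) -expRD subrr expR0.
  by rewrite mul1r; congr (_ * _); ring.
have c0 : 0 < c by exact: expR_gt0.
have Gm : moment (compound_poisson m V) g = c%:E.
  by rewrite -tilt_setT tiltG// probability_setT mule1.
have Gfin : (moment (compound_poisson m V) g < +oo)%E by rewrite Gm ltry.
split=> // S mS; have := tiltG _ mS.
rewrite tilt_esscher//; last exact: nonneg_law_compound_poisson.
rewrite Gm/= => /(congr1 (mule c^-1%:E)).
by rewrite !muleA -!EFinM mulVf ?gt_eqF// !mul1e.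
Qed.

End esscher_calculus.

(** * Transfer along the Esscher transform *)

Section esscher_transfer.
Context {R : realType}.
Variables (g T : R).
Hypothesis g0 : 0 <= g.
Implicit Types (V W : distr R) (x : R).
Local Notation E V := (esscher V g : distr R).
Local Notation phi := (fun x : R => expR (g * x)).
Local Notation tame V := (nonneg_law V /\ (moment V g < +oo)%E).

Let tilt_loc V x : tame V ->
  tilt V g `]x, x + T]%classic = (fine (moment V g) * loc (E V) T x)%:E.
Proof. by move=> [V0 Vfin]; rewrite tilt_esscher// EFinM EFin_loc. Qed.

Let itv_half x : 0 <= x ->
  `]x, x + T]%classic `&` `[0, +oo[%classic = `]x, x + T]%classic :> set R.
Proof.
move=> x0; apply/setIidPl => y /=; rewrite !in_itv/= andbT => /andP[/ltW xy _].
exact: le_trans xy.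
Qed.

Lemma esscher_loc_ge V x : tame V -> 0 <= x ->
  phi x * loc V T x <= fine (moment V g) * loc (E V) T x.
Proof.
move=> tV x0; rewrite -lee_fin -tilt_loc// /tilt itv_half// EFinM EFin_loc.
rewrite -integral_cst; last exact: measurable_itv.
apply: ge0_le_integral => //.
- by move=> y _; rewrite lee_fin expR_ge0.
- apply/measurable_EFinP; apply: (@measurable_funTS _ _ R R).
  by apply: measurableT_comp => //; exact: mulrl_measurable.
move=> y; rewrite /= in_itv/= => /andP[/ltW xy _].
by rewrite lee_fin ler_expR ler_wpM2l.
Qed.

Lemma esscher_loc_le V x : tame V -> 0 <= x ->
  fine (moment V g) * loc (E V) T x <= expR (g * T) * (phi x * loc V T x).
Proof.
move=> tV x0; rewrite -lee_fin -tilt_loc// /tilt itv_half//.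
rewrite mulrA -expRD EFinM EFin_loc -integral_cst; last exact: measurable_itv.
apply: ge0_le_integral => //.
- apply/measurable_EFinP; apply: (@measurable_funTS _ _ R R).
  by apply: measurableT_comp => //; exact: mulrl_measurable.
move=> y; rewrite /= in_itv/= => /andP[_ xy].
by rewrite lee_fin ler_expR -mulrDr ler_wpM2l// addrC.
Qed.

Let moment0 V : tame V -> 0 < fine (moment V g).
Proof. by move=> [V0 Vfin]; exact: fine_moment_gt0. Qed.

Lemma esscher_dominates V : tame V ->
  dominated (fun x => phi x * loc V T x) (loc (E V) T).
Proof.
move=> tV; exists (fine (moment V g)); first exact: moment0.
apply: filterS (near_pinfty_gt 0) => x /ltW x0; exact: esscher_loc_ge.
Qed.

Lemma dominates_esscher V : tame V ->
  dominated (loc (E V) T) (fun x => phi x * loc V T x).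
Proof.
move=> tV; exists ((fine (moment V g))^-1 * expR (g * T)).
  by rewrite mulr_gt0 ?expR_gt0// invr_gt0 moment0.
apply: filterS (near_pinfty_gt 0) => x /ltW x0.
by rewrite -mulrA ler_pdivlMl ?moment0// esscher_loc_le.
Qed.

Lemma dominatedM_phi (f h : R -> R) :
  dominated f h <-> dominated (fun x => phi x * f x) (fun x => phi x * h x).
Proof.
split=> -[C C0 CP]; exists C => //; apply: filterS CP => x.
  by rewrite mulrCA ler_pM2l ?expR_gt0.
by rewrite mulrCA ler_pM2l ?expR_gt0.
Qed.

Lemma dominated_esscher V W : tame V -> tame W ->
  dominated (loc V T) (loc W T) <-> dominated (loc (E V) T) (loc (E W) T).
Proof.
move=> tV tW; split=> [/dominatedM_phi VW|VW].
  apply: dominated_trans (dominates_esscher tV) _.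
  exact: dominated_trans VW (esscher_dominates tW).
apply/dominatedM_phi; apply: dominated_trans (esscher_dominates tV) _.
exact: dominated_trans VW (dominates_esscher tW).
Qed.

Lemma negligible_esscher V W : tame V -> tame W ->
  negligible (loc V T) (loc W T) -> negligible (loc (E V) T) (loc (E W) T).
Proof.
move=> tV tW VW; have [C C0 CP] := dominates_esscher tV.
apply: negligible_dominated_trans (esscher_dominates tW) => e e0.
have eC0 : 0 < e / C by rewrite divr_gt0.
apply: filterS2 CP (VW _ eC0) => x h1 h2; apply: (le_trans h1).
rewrite -ler_pdivlMl//.
rewrite [leRHS](_ : _ = phi x * (e / C * loc W T x)); last by rewrite /=; ring.
by rewrite ler_wpM2l// expR_ge0.
Qed.

Lemma loc_pos_esscher V : tame V -> loc_pos V T <-> loc_pos (E V) T.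
Proof.
move=> tV; split=> Vpos.
  apply: filterS2 (near_pinfty_gt 0) Vpos => x /ltW x0 vx.
  rewrite -(pmulr_rgt0 _ (moment0 tV)).
  by apply: lt_le_trans (esscher_loc_ge tV x0); rewrite mulr_gt0 ?expR_gt0.
apply: filterS2 (near_pinfty_gt 0) Vpos => x /ltW x0 vx.
have /lt_le_trans/(_ (esscher_loc_le tV x0)) := mulr_gt0 (moment0 tV) vx.
by rewrite !pmulr_rgt0 ?expR_gt0.
Qed.

Lemma tame_convol V W : tame V -> tame W -> tame (convol V W).
Proof.
move=> [V0 Vfin] [W0 Wfin]; split; first exact: nonneg_law_convol.
by rewrite moment_convol// -EFin_moment// -(EFin_moment g0 W0)// -EFinM ltry.
Qed.

Lemma classOS_esscher V : tame V -> classOS T V <-> classOS T (E V).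
Proof.
move=> tV; have tVV := tame_convol tV tV; have [V0 Vfin] := tV.
have -> : classOS T V = (loc_pos V T /\ dominated (loc (convol V V) T) (loc V T)).
  exact/propext/classOSP.
have -> : classOS T (E V) =
    (loc_pos (E V) T /\ dominated (loc (E (convol V V)) T) (loc (E V) T)).
  rewrite (_ : loc (E (convol V V)) T = loc (convol (E V) (E V)) T).
    exact/propext/classOSP.
  by apply/funext => x; apply: eq_loc; exact: esscher_convol.
by split=> -[/(loc_pos_esscher tV) ? /(dominated_esscher tVV tV) ?]; split.
Qed.

Lemma eq_classL V W : same_law V W -> classL T V -> classL T W.
Proof.
move=> VW; have VWloc : loc V T = loc W T by apply/funext => x; exact: eq_loc.
by move=> /classLP[h1 h2 h3]; apply/classLP; rewrite /loc_pos -VWloc.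
Qed.

Lemma eq_classOS V W : same_law V W -> classOS T V -> classOS T W.
Proof.
move=> VW; have VWloc : loc V T = loc W T by apply/funext => x; exact: eq_loc.
have VVloc : loc (convol V V) T = loc (convol W W) T.
  by apply/funext => x; apply: eq_loc; exact: eq_convol.
by move=> /classOSP[h1 h2]; apply/classOSP; rewrite /loc_pos -VWloc -VVloc.
Qed.

Lemma classTL_OS_esscher V W : tame V -> same_law (E V) W ->
  classL T W /\ classOS T W -> classTL T g V /\ classOS T V.
Proof.
move=> tV EVW [WL WOS]; have WEV : same_law W (E V) by move=> S /EVW.
split; first by split; [case: tV|exact: eq_classL WL].
by apply/(classOS_esscher tV); exact: eq_classOS WOS.
Qed.

End esscher_transfer.

(** * Infinitely divisible laws *)

Lemma spectral_law_nonneg (R : realType) (a : R)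
    (nu : {measure set (measurableTypeR R) -> \bar R}) :
  levy_data a nu -> nonneg_law (spectral_law nu).
Proof.
move=> [_ _ nu0 nufin _].
have mu1 : (big_jumps nu setT = nu `]1%R, +oo[%classic)%E.
  by rewrite /big_jumps /= /mrestr setTI.
rewrite /nonneg_law.
have -> : (spectral_law nu `]-oo, 0%R[%classic =
    big_jumps nu `]-oo, 0%R[%classic * ((fine (big_jumps nu setT))^-1)%:E)%E.
  by apply: mnormalizeE; rewrite mu1.
rewrite (_ : big_jumps nu _ = 0%E) ?mul0e//.
rewrite /big_jumps /= /mrestr (_ : _ `&` _ = set0) ?measure0//.
apply/seteqP; split => y //=; rewrite !in_itv/= andbT => -[h1 h2].
by move: (lt_trans ltr01 (lt_trans h2 h1)); rewrite ltxx.
Qed.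

Theorem theorem4p2 (R : realType) (a : R)
    (nu : {measure set (measurableTypeR R) -> \bar R}) (H H1 : distr R)
    (T g : R) :
  levy_data a nu ->
  id_law a nu H ->
  id_law a (small_jumps nu) H1 ->
  (forall A, measurable A -> H A = convol H1 (big_part nu) A) ->
  0 < T -> 0 < g ->
  classTL T g H -> classOS T H ->
  negligible_wrt (loc H1 T) (loc (big_part nu) T) ->
  (forall k, (1 <= k)%N ->
     loc_almost_decreasing T (convol_pow (esscher (spectral_law nu) g) k)) ->
  let F := spectral_law nu in
  let H2 := big_part nu in
  [/\ [/\ classTL T g H2, classOS T H2 & weakly_equiv (loc H2 T) (loc H T)],
      exists n0, (1 <= n0)%N /\
        forall n, (n0 <= n)%N ->
          classTL T g (convol_pow F n) /\ classOS T (convol_pow F n),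
      forall n0, (1 <= n0)%N ->
        (forall n, (n0 <= n)%N ->
           classTL T g (convol_pow F n) /\ classOS T (convol_pow F n)) ->
        (2 <= n0)%N ->
        forall l0, (1 <= l0 <= n0.-1)%N -> classOS T (convol_pow F l0) ->
        forall n, (l0 <= n)%N ->
          classTL T g (convol_pow F n) /\ classOS T (convol_pow F n) &
      classOS T F -> classTL T g F /\ classOS T F].
Proof.
move=> nuP [_ H0 _] [_ H10 _] HE T0 g0 [Hfin HL] HOS H1neg Fd F H2.
have g_ge0 := ltW g0.
have F0 : nonneg_law F by exact: spectral_law_nonneg nuP.
have m0 : 0 < (levy_mass nu)%:num.
  by case: nuP => _ _ nu0 nufin _; rewrite /= fine_gt0// nu0.
have H20 : nonneg_law H2 by exact: nonneg_law_compound_poisson.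
have [H1fin H2fin] : (moment H1 g < +oo)%E /\ (moment H2 g < +oo)%E.
  move: Hfin; rewrite (eq_moment g HE) (moment_convol g_ge0 H10 H20).
  have := moment_gt0 g_ge0 H10; have := moment_gt0 g_ge0 H20.
  case: (moment H1 g) => [r1||]//; case: (moment H2 g) => [r2||]// p2 p1.
  - by rewrite !ltry.
  - by rewrite gt0_muley.
  - by rewrite gt0_mulye.
have Ffin : (moment F g < +oo)%E.
  exact: moment_compound_poisson_lty m0 F0 H2fin.
have M0 := fine_moment_gt0 g_ge0 F0 Ffin.
pose m := NngNum (ltW (mulr_gt0 m0 M0)).
have [_ EH2] :=
  @esscher_compound_poisson R g g_ge0 (levy_mass nu) m F F0 Ffin erefl.
have EF0 : nonneg_law (esscher F g) by exact: nonneg_law_esscher.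
have EH10 : nonneg_law (esscher H1 g) by exact: nonneg_law_esscher.
have EH : same_law (esscher H g)
    (convol (esscher H1 g) (compound_poisson m (esscher F g))).
  move=> S mS; rewrite (eq_esscher g_ge0 H0 Hfin HE mS) esscher_convol//.
  exact: eq_convol.
have tH : nonneg_law H /\ (moment H g < +oo)%E by [].
have tH1 : nonneg_law H1 /\ (moment H1 g < +oo)%E by [].
have tH2 : nonneg_law H2 /\ (moment H2 g < +oo)%E by [].
have tF n : nonneg_law (convol_pow F n) /\ (moment (convol_pow F n) g < +oo)%E.
  by split; [exact: nonneg_law_convol_pow|exact: moment_convol_pow_lty].
have EOS : classOS T (esscher H g) by apply/(classOS_esscher T g_ge0 tH).
have Eneg : negligible (loc (esscher H1 g) T)
    (loc (compound_poisson m (esscher F g)) T).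
  rewrite (_ : loc (compound_poisson _ _) T = loc (esscher H2 g) T); last first.
    by apply/funext => x; apply/esym/eq_loc.
  apply: (negligible_esscher g_ge0 tH1 tH2).
  by apply/negligible_wrt_le => // x; exact: loc_ge0.
have m'0 : 0 < m%:num by exact: mulr_gt0.
have FE n := esscher_convol_pow g_ge0 n F0 Ffin.
have powers n : (classL T (convol_pow (esscher F g) n) /\
    classOS T (convol_pow (esscher F g) n)) ->
    classTL T g (convol_pow F n) /\ classOS T (convol_pow F n).
  exact: (classTL_OS_esscher g_ge0 (tF n) (FE n)).
have fromOS l : (1 <= l)%N -> classOS T (convol_pow F l) -> forall n,
    (l <= n)%N -> classTL T g (convol_pow F n) /\ classOS T (convol_pow F n).
  move=> l1 /(classOS_esscher T g_ge0 (tF l))/(eq_classOS (FE l)) OSl n ln.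
  apply: powers.
  exact: (classOS_convol_pow_classes T0 m'0 EF0 EH10 EH HL EOS Eneg Fd l1 OSl).
split.
- have [] := classTL_OS_esscher g_ge0 tH2 EH2 (conj
    (factor_classL T0 m'0 EF0 EH10 EH HL EOS Eneg Fd)
    (factor_classOS T0 m'0 EF0 EH10 EH HL EOS Eneg Fd)).
  split=> //; apply/weakly_equiv_dominated; try by move=> x; exact: loc_ge0.
  have EH2loc : loc (compound_poisson m (esscher F g)) T = loc (esscher H2 g) T.
    by apply/funext => x; apply/esym/eq_loc.
  split; apply/(dominated_esscher T g_ge0) => //; rewrite -EH2loc.
    exact: (factor_dominated T0 EH10 EH HL).
  exact: (dominated_by_factor T0 m'0 EF0 EH10 EH HL EOS Eneg Fd).
- have [n0 [n01 Hn]] :=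
    convol_pow_classes_eventually T0 m'0 EF0 EH10 EH HL EOS Eneg Fd.
  by exists n0; split=> // n n0n; apply: powers; exact: Hn.
- by move=> n0 _ _ _ l0 /andP[l01 _]; exact: fromOS.
move=> FOS; split=> //.
have F1 : same_law F (convol_pow F 1) by move=> S mS; rewrite convol_pow1.
have [[_ L1] _] := fromOS 1%N isT (eq_classOS F1 FOS) 1%N isT.
split=> //; apply: eq_classL L1; apply: (eq_esscher g_ge0).
- by have [] := tF 1%N.
- by have [] := tF 1%N.
exact: convol_pow1.
Qed.
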